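(* Let $I=[0,1]$ with $\mathcal{L}$ the Lebesgue measure, and $K=\mathbb{R}/\mathbb{Z}$. Assume $f:[0,1]\to\mathbb{R}/\mathbb{Z}$ is a $C^2$-map such that $f'$ does not vanish. Then for all $\mu\in\mathcal{M}_{\mathcal{L}}$, $\mathcal{D}_{kf}*\mu\to\lambda$ when $k\to\pm\infty$ ($k\in\mathbb{Z}$).
   Context: $\mathcal{M}_{\mathcal{L}}$ is the set of probability measures on $I\times K$ whose projection to $I$ is $\mathcal{L}$, endowed with the weak-* topology (tested against continuous functions on $[0,1]\times K$). For a measurable map $g:I\to K$, $\mathcal{D}_g\in\mathcal{M}_{\mathcal{L}}$ is the pushforward of $\mathcal{L}$ by $x\mapsto (x,g(x))$; $kf$ is the map $x\mapsto kf(x)$. Each $\mu\in\mathcal{M}_{\mathcal{L}}$ has a disintegration $(\mu^x)_{x\in I}$ along $\mathcal{L}$ into probability measures on $K$; the fiberwise convolution $\mu*\nu\in\mathcal{M}_{\mathcal{L}}$ is defined by $(\mu*\nu)^x=\mu^x*\nu^x$ for $\mathcal{L}$-a.e. $x$. $\lambda=\mathcal{L}\otimes\mathrm{Haar}_K$, with $\mathrm{Haar}_K$ the Haar probability measure on $K$. *)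

(* Defs.v *)
From HB Require Import structures.
From mathcomp Require Import all_boot all_order all_algebra.
From mathcomp Require Import generic_quotient ring_quotient.
From mathcomp Require Import all_classical all_reals all_analysis.
From mathcomp Require Import measurable_realfun giry lra zify.
From Stdlib Require Import Lia.

Set Implicit Arguments.
Unset Strict Implicit.
Unset Printing Implicit Defensive.
Import Order.TTheory GRing.Theory Num.Theory.
Import numFieldNormedType.Exports.

Local Open Scope classical_set_scope.
Local Open Scope ring_scope.

(* The subgroup Z of R. *)
Definition integers (R : realType) : zmodClosed R :=
  GRing.ZmodClosed.clone R (@Num.int_num_subdef R) _.

(* K = R/Z. Below it gets the quotient topology (U is open iff its preimage under
   circle_pi is open) and the corresponding Borel sigma-algebra. *)
Definition circle (R : realType) : Type := {ideal_quot (integers R)}.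

Definition circle_pi (R : realType) : R -> circle R :=
  \pi_({ideal_quot (integers R)})%qT.

Section circle_structures.
Context {R : realType}.

HB.instance Definition _ := GRing.Zmodule.on (circle R).
HB.instance Definition _ := isPointed.Build (circle R) 0.

Let circle_open (U : set (circle R)) := open (@circle_pi R @^-1` U).

Let circle_openT : circle_open setT. Proof. exact: openT. Qed.

Let circle_openI : setI_closed circle_open.
Proof. by move=> U V; exact: openI. Qed.

Let circle_open_bigcup (J : Type) (g : J -> set (circle R)) :
  (forall i, circle_open (g i)) -> circle_open (\bigcup_i g i).
Proof. by move=> og; apply: bigcup_open => i _; exact: og. Qed.

HB.instance Definition _ := isOpenTopological.Build (circle R)
  circle_openT circle_openI circle_open_bigcup.
HB.instance Definition _ :=
  Measurable.copy (circle R) (g_sigma_algebraType (@open (circle R))).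

End circle_structures.

(* I = [0, 1] as a type, with the subspace topology and its Borel
   sigma-algebra. *)
Definition unitI (R : realType) : Type := `[0 : R, 1 : R]%classic.

Section unitI_structures.
Context {R : realType}.

HB.instance Definition _ := Topological.copy (unitI R)
  (set_type (`[0 : R, 1 : R]%classic)).

Let unitI0 : (0:R) \in `[0 : R, 1 : R]%classic.
Proof. by rewrite inE/= in_itv/= lexx ler01. Qed.

HB.instance Definition _ := isPointed.Build (unitI R) (exist _ 0 unitI0).
HB.instance Definition _ :=
  Measurable.copy (unitI R) (g_sigma_algebraType (@open (unitI R))).

End unitI_structures.

Definition unitI_val (R : realType) (x : unitI R) : R := \val x.

Section circle_lemmas.
Context {R : realType}.
Implicit Types x y : R.

Lemma circle_piD x y : circle_pi (x + y) = circle_pi x + circle_pi y.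
Proof. exact: Quotient.pi_add. Qed.

Lemma circle_piN x : circle_pi (- x) = - circle_pi x.
Proof. exact: Quotient.pi_opp. Qed.

Lemma circle_pi_eq x y : (circle_pi x = circle_pi y) <-> (x - y \is a Num.int).
Proof.
have -> : (x - y \is a Num.int) = (x - y \in integers R) by [].
by rewrite Quotient.idealrBE; split => [/eqP|/eqP].
Qed.

Lemma continuous_circle_pi : continuous (@circle_pi R).
Proof. by apply/continuousP => A. Qed.

Lemma circle_pi_openP (U : set R) : open U -> open (@circle_pi R @` U).
Proof.
move=> oU; rewrite /open/= (_ : _ @^-1` _ =
    \bigcup_(n in [set: int]) (fun x => x + n%:~R) @^-1` U); last first.
  apply/seteqP; split=> [x/= [y Uy /circle_pi_eq]|x/= [n _ /= Uxn]].
    by move=> /intrP[n yxn]; exists n => //=; rewrite -yxn addrC subrK.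
  exists (x + n%:~R) => //; apply/circle_pi_eq.
  by rewrite addrC addKr intr_int.
apply: bigcup_open => n _.
apply: open_comp => // x _; apply: cvgD; [exact: cvg_id|exact: cvg_cst].
Qed.

(* The representative in [0, 1[. *)
Definition circle_frac (z : circle R) : R :=
  let x := repr (z : {ideal_quot (integers R)}) in x - (Num.floor x)%:~R.

Lemma circle_fracK : cancel circle_frac (@circle_pi R).
Proof.
move=> z; rewrite -[RHS](@reprK _ {ideal_quot (integers R)}).
apply/circle_pi_eq; rewrite /circle_frac/= addrAC subrr add0r rpredN.
exact: intr_int.
Qed.

Lemma circle_frac_itv z : 0 <= circle_frac z < 1.
Proof.
rewrite /circle_frac; set x := repr _.
have /andP[h1 h2] := floor_itv x.
by rewrite subr_ge0 h1/= ltrBlDl -[X in _ + X](_ : 1%:~R = 1)// -intrD.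
Qed.

Lemma circle_piK x : 0 <= x < 1 -> circle_frac (circle_pi x) = x.
Proof.
move=> /andP[x0 x1]; have /andP[y0 y1] := circle_frac_itv (circle_pi x).
have /circle_pi_eq/intrP[n xn] := circle_fracK (circle_pi x).
have : `|n%:~R : R| < 1 by rewrite -xn ltr_norml; apply/andP; split; lra.
rewrite -intr_norm (_ : 1 = 1%:~R)// ltr_int => n1.
have n0 : n = 0 by apply/eqP; rewrite -normr_eq0; move: n1; lia.
by apply/eqP; rewrite -subr_eq0 xn n0.
Qed.

Lemma measurable_circle_pi : measurable_fun setT (@circle_pi R).
Proof.
apply: (measurability (@open (circle R))) => //.
move=> _ [U oU <-]; rewrite setTI; exact: open_measurable.
Qed.

Lemma open_measurable_circle (U : set (circle R)) : open U -> measurable U.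
Proof. exact: sub_sigma_algebra. Qed.

Lemma measurable_circle_frac : measurable_fun setT circle_frac.
Proof.
apply: (measurability _ (RGenInftyO.measurableE R)).
move=> _ [_ [b ->] <-]; rewrite setTI.
have [b0|b0] := leP b 0.
  rewrite (_ : _ @^-1` _ = set0)//; apply/seteqP; split => // z/=.
  rewrite in_itv/=; have /andP[] := circle_frac_itv z; lra.
have [b1|b1] := leP 1 b.
  rewrite (_ : _ @^-1` _ = setT)//; apply/seteqP; split => // z/= _.
  rewrite in_itv/=; have /andP[] := circle_frac_itv z; lra.
rewrite (_ : _ @^-1` _ = ~` (@circle_pi R @` `]0, 1[) `|` (@circle_pi R @` `]0, b[)).
  apply: measurableU; first apply: measurableC;
  apply: open_measurable_circle; apply: circle_pi_openP; exact: itv_open.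
have fp z : 0 < circle_frac z -> (@circle_pi R @` `]0, 1[) z.
  move=> z0; exists (circle_frac z); last exact: circle_fracK.
  by rewrite /= in_itv/= z0; have /andP[] := circle_frac_itv z.
apply/seteqP; split => z/=; rewrite in_itv/=.
  move=> zb; have [z0|z0] := ltP 0 (circle_frac z).
    right; exists (circle_frac z); last exact: circle_fracK.
    by rewrite /= in_itv/= z0.
  left => -[x/=]; rewrite in_itv/= => /andP[x0 x1] xz.
  by move: z0; rewrite -xz circle_piK ?(ltW x0)// leNgt x0.
move=> [|[x]/=].
  apply: contra_notT; rewrite -leNgt => bz; apply: fp; exact: lt_le_trans bz.
by rewrite in_itv/= => /andP[x0 xb] <-; rewrite circle_piK ?(ltW x0)//; lra.
Qed.

Lemma measurable_circleD :
  measurable_fun setT (fun p : circle R * circle R => p.1 + p.2).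
Proof.
rewrite (_ : (fun p : circle R * circle R => p.1 + p.2) =
  (fun p => circle_pi (circle_frac p.1 + circle_frac p.2))); last first.
  by apply/funext => p; rewrite circle_piD !circle_fracK.
apply: measurableT_comp; first exact: measurable_circle_pi.
apply: measurable_funD; apply: measurableT_comp => //; exact: measurable_circle_frac.
Qed.

End circle_lemmas.
Section unitI_lemmas.
Context {R : realType}.

Lemma unitI_val_itv (x : unitI R) : unitI_val x \in `[0, 1].
Proof. by have := set_valP x. Qed.

Lemma unitI_measurableP (A : set (unitI R)) : measurable A <->
  exists2 B : set R, measurable B & A = @unitI_val R @^-1` B.
Proof.
have E : @measurable _ (unitI R) =
    preimage_set_system setT (@unitI_val R) (@measurable _ R).
  transitivity (<<s setT, preimage_set_system setT (@unitI_val R) (@open R)>>).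
    rewrite /measurable/=; congr (<<s _ >>).
    apply/seteqP; split => [U [V oV <-]|_ [V oV <-]].
      by exists V => //; rewrite setTI.
    by exists V => //; rewrite setTI.
  rewrite g_sigma_preimageE; congr (preimage_set_system _ _ _).
  apply/seteqP; split.
    apply: smallest_sub; first exact: sigma_algebra_measurable.
    by move=> U; exact: open_measurable.
  rewrite (RGenOpens.measurableE R : @measurable _ R = _).
  apply: smallest_sub; first exact: sigma_algebra_measurable.
  move=> _ [a [b ->]]; apply: sub_sigma_algebra; exact: itv_open.
rewrite E; split => [[B mB <-]|[B mB ->]].
  by exists B => //; rewrite setTI.
by exists B => //; rewrite setTI.
Qed.

Lemma measurable_unitI_val : measurable_fun setT (@unitI_val R).
Proof. by move=> _ B mB; rewrite setTI; apply/unitI_measurableP; exists B. Qed.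

Lemma image_unitI_val_preimage (B : set R) :
  @unitI_val R @` (@unitI_val R @^-1` B) = B `&` `[0, 1].
Proof.
apply/seteqP; split => [_ [x Bx <-]|x [Bx x01]].
  by split => //; exact: unitI_val_itv.
by exists (exist _ x (mem_set x01)).
Qed.

Lemma measurable_image_unitI_val (A : set (unitI R)) :
  measurable A -> measurable (@unitI_val R @` A).
Proof.
move=> /unitI_measurableP[B mB ->]; rewrite image_unitI_val_preimage.
exact: measurableI.
Qed.

Definition lebesgueI (A : set (unitI R)) : \bar R :=
  lebesgue_measure (@unitI_val R @` A).

Let lebesgueI0 : lebesgueI set0 = 0%E.
Proof. by rewrite /lebesgueI image_set0 measure0. Qed.

Let lebesgueI_ge0 A : (0 <= lebesgueI A)%E.
Proof. exact: measure_ge0. Qed.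

Let lebesgueI_sigma_additive : semi_sigma_additive lebesgueI.
Proof.
move=> F mF tF mUF; rewrite /lebesgueI image_bigcup.
apply: measure_semi_sigma_additive.
- by move=> n; exact: measurable_image_unitI_val.
- apply/trivIsetP => i j _ _ ij; move/trivIsetP: tF => /(_ i j I I ij) Fij.
  apply/seteqP; split => // _ [[x Fx <-] [y Fy]] yx.
  suff : set0 x by [].
  by rewrite -Fij; split => //; rewrite -(val_inj yx).
- by rewrite -image_bigcup; exact: measurable_image_unitI_val.
Qed.

HB.instance Definition _ := isMeasure.Build _ _ _ lebesgueI
  lebesgueI0 lebesgueI_ge0 lebesgueI_sigma_additive.

Let lebesgueI_setT : lebesgueI setT = 1%E.
Proof.
rewrite /lebesgueI -(preimage_setT (@unitI_val R)) image_unitI_val_preimage.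
by rewrite setTI lebesgue_measure_itv/= lte_fin ltr01 oppr0 adde0.
Qed.

HB.instance Definition _ :=
  Measure_isProbability.Build _ _ _ lebesgueI lebesgueI_setT.

Lemma lebesgueI_preimage (B : set R) : measurable B ->
  lebesgueI (@unitI_val R @^-1` B) = lebesgue_measure (B `&` `[0, 1]).
Proof. by move=> mB; rewrite /lebesgueI image_unitI_val_preimage. Qed.

End unitI_lemmas.
Section pushforward_probability.
Context d d' {T : measurableType d} {T' : measurableType d'} {R : realType}.
Variables (P : probability T R) (g : T -> T') (mg : measurable_fun setT g).
#[local] HB.instance Definition _ := isMeasurableFun.Build _ _ _ _ g mg.

Definition pushforward_prob : probability T' R := distribution P g.

Lemma pushforward_probE A : pushforward_prob A = P (g @^-1` A).
Proof. by []. Qed.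

End pushforward_probability.

Lemma lebesgue_measure_shift (R : realType) (s : R) (A : set R) :
  measurable A ->
  lebesgue_measure ((fun x : R => x + s) @^-1` A) = lebesgue_measure A.
Proof.
have ms : measurable_fun setT ((fun x => x + s) : R -> measurableTypeR R).
  by apply: measurable_funD => //; exact: measurable_cst.
move=> mA; apply/esym.
pose g : R -> measurableTypeR R := fun x => x + s.
apply: (@lebesgue_measure_unique R (pushforward lebesgue_measure g)) => // _ [[a b]] _ <-.
transitivity (lebesgue_measure (`]a - s, b - s]%classic : set R)); last first.
  congr (lebesgue_measure _).
  by apply/seteqP; split => x; rewrite /g/= !in_itv/=; lra.
by rewrite !lebesgue_measure_itv/= !lte_fin ltrD2r; case: ifPn => // _;
  rewrite !EFinN -!EFinB opprB addrA subrK.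
Qed.

Section haar.
Context {R : realType}.

Lemma measurable_circle_pi_unitI :
  measurable_fun setT (@circle_pi R \o @unitI_val R).
Proof.
exact: measurableT_comp measurable_circle_pi measurable_unitI_val.
Qed.

(* The image of the Lebesgue measure; haar_shift shows that it is the
   translation-invariant probability measure on R/Z. *)
Definition haar : probability (circle R) R :=
  pushforward_prob (@lebesgueI R) measurable_circle_pi_unitI.

Let leb_split (B : set R) (a b c : R) : measurable B -> a <= b <= c ->
  lebesgue_measure (B `&` `[a, c[) =
  (lebesgue_measure (B `&` `[a, b[) + lebesgue_measure (B `&` `[b, c[))%E.
Proof.
move=> mB /andP[ab bc]; rewrite -measureU; last 3 first.
- exact: measurableI.
- exact: measurableI.
- apply/seteqP; split => // x/= [[_]]; rewrite !in_itv/=.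
  by move=> /andP[_ xb] [_] /andP[]; rewrite leNgt xb.
congr (lebesgue_measure _); rewrite -setIUr; congr (_ `&` _).
by apply/seteqP; split => x/=; rewrite !in_itv/=;
  [move=> ?; have [?|?] := ltP x b; [left|right]; lra|move=> [|] ?; lra].
Qed.

Lemma haarE (A : set (circle R)) : measurable A ->
  haar A = lebesgue_measure (@circle_pi R @^-1` A `&` `[0, 1[).
Proof.
move=> mA.
have mB : measurable (@circle_pi R @^-1` A).
  by rewrite -[X in measurable X]setTI; exact: measurable_circle_pi.
rewrite -[LHS]/(lebesgueI (@unitI_val R @^-1` (@circle_pi R @^-1` A))).
rewrite lebesgueI_preimage//.
rewrite -(@setUitv1 _ _ _ _ true) ?bnd_simp// setIUr measureU//; last 3 first.
- exact: measurableI.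
- exact: measurableI.
- apply/seteqP; split => // x/= [[_]]; rewrite in_itv/= => + [_ x1].
  by rewrite x1 ltxx andbF.
rewrite [X in (_ + X)%E](_ : _ = 0%E) ?adde0//.
apply/eqP; rewrite eq_le measure_ge0 andbT.
by rewrite -(lebesgue_measure_set1 (1 : R)) le_measure// ?inE//; exact: measurableI.
Qed.

Lemma haar_shift (t : circle R) (A : set (circle R)) : measurable A ->
  haar ((fun z => z + t) @^-1` A) = haar A.
Proof.
move=> mA.
have mAt : measurable ((fun z => z + t) @^-1` A).
  rewrite -[X in measurable X]setTI.
  have : measurable_fun setT ((fun p : circle R * circle R => p.1 + p.2) \o
      (fun z => (z, t))).
    by apply: measurableT_comp; [exact: measurable_circleD|exact: measurable_fun_pair].
  by move=> /(_ measurableT A mA).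
rewrite !haarE//; set B := circle_pi (R:=R) @^-1` A.
have mB : measurable B.
  by rewrite -[X in measurable X]setTI; exact: measurable_circle_pi.
have Bper x : B (x - 1) = B x.
  rewrite /B/=; congr (A _); apply/circle_pi_eq.
  by rewrite addrAC subrr add0r rpredN; exact: intr_int 1.
pose s := circle_frac t.
have /andP[s0 s1] : 0 <= s < 1 := circle_frac_itv t.
rewrite (_ : _ `&` _ = (fun x => x + s) @^-1` (B `&` `[s, s + 1[)); last first.
  apply/seteqP; split => x/=; rewrite /B/= !in_itv/= circle_piD circle_fracK;
    move=> [? ?]; split => //; lra.
rewrite lebesgue_measure_shift; last exact: measurableI.
rewrite (@leb_split B s 1 (s + 1))//; last lra.
rewrite (_ : B `&` `[1, s + 1[ = (fun x => x - 1) @^-1` (B `&` `[0, s[)); last first.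
  apply/seteqP; split => x/=; rewrite !in_itv/= Bper;
    move=> [? ?]; split => //; lra.
rewrite lebesgue_measure_shift; last exact: measurableI.
by rewrite addeC -leb_split//; lra.
Qed.

End haar.
Section circle_convolution.
Context {R : realType}.

Definition convolution (P Q : probability (circle R) R) :
    probability (circle R) R :=
  pushforward_prob (P \x Q)%E measurable_circleD.

Lemma convolutionE (P Q : probability (circle R) R) A :
  convolution P Q A = (P \x Q)%E [set p | A (p.1 + p.2)].
Proof. by []. Qed.

End circle_convolution.

Lemma measurable_pprobability d d' (T : measurableType d)
    (T' : measurableType d') (R : realType) (k : T -> pprobability T' R) :
  (forall B, measurable B -> measurable_fun setT (fun x => k x B)) ->
  measurable_fun setT k.
Proof.
move=> mk; apply: (@measurability _ _ T (pprobability T' R) setT k (@pset _ T' R)) => //.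
move=> _ [_ [r r01 [B mB <-]] <-].
rewrite setTI (_ : _ @^-1` _ = (fun x => k x B) @^-1` `]-oo, r%:E[); last first.
  by apply/seteqP; split => x/=; rewrite in_itv.
rewrite -[X in measurable X]setTI; apply: mk => //; exact: emeasurable_itv.
Qed.

Lemma measurable_pprobability_ev d d' (T : measurableType d)
    (T' : measurableType d') (R : realType) (k : T -> pprobability T' R) B :
  measurable_fun setT k -> measurable B -> measurable_fun setT (fun x => k x B).
Proof. by move=> mk mB; exact: (measurable_kernel (kprobability mk)). Qed.

Lemma measurable_convolution (R : realType) d (T : measurableType d)
    (k1 k2 : T -> pprobability (circle R) R) :
  measurable_fun setT k1 -> measurable_fun setT k2 ->
  measurable_fun setT
    (fun x => convolution (k1 x) (k2 x) : pprobability (circle R) R).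
Proof.
move=> mk1 mk2; apply: measurable_pprobability => B mB.
have mB' : measurable [set p : circle R * circle R | B (p.1 + p.2)].
  by rewrite -[X in measurable X]setTI; exact: measurable_circleD.
pose g (x : T) : giry (circle R) R * giry (circle R) R := 
    ((k1 x : probability _ R) : subprobability _ R,
     (k2 x : probability _ R) : subprobability _ R).
have mg : measurable_fun setT g.
  apply: measurable_fun_pair => /=; apply: measurable_giry_codensity => // C mC;
  exact: measurable_pprobability_ev.
have := measurableT_comp measurable_giry_prod mg.
exact: measurableT_comp (measurable_giry_ev mB').
Qed.

Section leb_measure.
Context (R : realType).
Local Notation I := (unitI R).
Local Notation K := (circle R).

(* Probability measures on I * K whose projection to I is the Lebesgue measure. *)
Record leb_measure := LebMeasure {
  leb_prob :> probability (I * K)%type R ;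
  leb_fst : forall A, measurable A ->
    pushforward leb_prob fst A = lebesgueI A }.

HB.instance Definition _ := gen_eqMixin leb_measure.
HB.instance Definition _ := gen_choiceMixin leb_measure.

(* The weak-* topology is the initial topology of all the maps
   mu |-> \int phi d mu with phi continuous on I * K; see leb_cvgP. *)
Definition leb_eval (mu : leb_measure) :
    {ptws continuousType (I * K)%type R -> R} :=
  fun phi => \int[mu]_z phi z.

HB.instance Definition _ :=
  Topological.copy leb_measure (initial_topology leb_eval).

Lemma haar_fst A : measurable A ->
  pushforward (@lebesgueI R \x haar)%E fst A = lebesgueI A.
Proof.
move=> mA; rewrite /pushforward (_ : fst @^-1` A = A `*` setT); last first.
  by apply/seteqP; split => // x [].
rewrite product_measure1E// -[RHS]mule1; congr (_ * _)%E.
exact: (probability_setT haar).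
Qed.

Definition leb_haar : leb_measure := LebMeasure haar_fst.

Lemma measurable_graph (g : I -> K) : measurable_fun setT g ->
  measurable_fun setT (fun x => (x, g x)).
Proof. by move=> mg; exact: measurable_fun_pair. Qed.

Definition graph_measure (g : I -> K) (mg : measurable_fun setT g) :
    leb_measure :=
  @LebMeasure (pushforward_prob (@lebesgueI R) (measurable_graph mg))
    (fun A _ => erefl).

Definition disintegrates (mu : leb_measure) (k : I -> pprobability K R) :=
  measurable_fun setT k /\
  forall A B, measurable A -> measurable B ->
    mu (A `*` B) = (\int[lebesgueI]_(x in A) k x B)%E.

(* A chosen disintegration (mu^x)_x of mu. One exists for every mu because I * K
   is compact metrizable, and it is unique up to a Lebesgue-null set of x;
   the default value of get is therefore never used. *)
Definition disintegration (mu : leb_measure) : I -> pprobability K R :=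
  get [set k | disintegrates mu k].

Lemma measurable_disintegration mu : measurable_fun setT (disintegration mu).
Proof.
have [e|ne] := pselect (exists k, disintegrates mu k).
  by have [] : disintegrates mu (disintegration mu) := getPex e.
rewrite /disintegration (_ : get _ = fun=> point); last first.
  by apply: xgetPN => k dk; apply: ne; exists k.
exact: measurable_cst.
Qed.

Section fibers.
Variables (k : I -> pprobability K R) (mk : measurable_fun setT k).

(* The measure on I * K with fibers k x over the Lebesgue measure. *)
Definition of_fibers (A : set (I * K)) : \bar R :=
  (\int[lebesgueI]_x k x (xsection A x))%E.

Let of_fibers0 : of_fibers set0 = 0%E.
Proof. by apply: integral0_eq => x _; rewrite xsection0 measure0. Qed.

Let of_fibers_ge0 A : (0 <= of_fibers A)%E.
Proof. exact: integral_ge0. Qed.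

Let measurable_fiber A : measurable A ->
  measurable_fun setT (fun x => k x (xsection A x)).
Proof.
move=> mA; apply: (measurable_fun_xsection_finite_kernel (kprobability mk)).
exact: mem_set.
Qed.

Let of_fibers_sigma_additive : semi_sigma_additive of_fibers.
Proof.
move=> F mF tF mUF.
rewrite [X in _ --> X](_ : _ = (\int[lebesgueI]_x
    (\sum_(0 <= i <oo) k x (xsection (F i) x)))%E); last first.
  apply: eq_integral => x _; rewrite xsection_bigcup.
  apply: measure_semi_bigcup.
  - by move=> i; exact: measurable_xsection.
  - exact: trivIset_xsection.
  - by apply: bigcup_measurable => i _; exact: measurable_xsection.
rewrite integral_nneseries//; last by move=> n; exact: measurable_fiber.
apply: is_cvg_nneseries => n *; exact: integral_ge0.
Qed.

HB.instance Definition _ := isMeasure.Build _ _ _ of_fibers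
  of_fibers0 of_fibers_ge0 of_fibers_sigma_additive.

Let of_fibers_setX A B : measurable A ->
  of_fibers (A `*` B) = (\int[lebesgueI]_(x in A) k x B)%E.
Proof.
move=> mA; rewrite /of_fibers [RHS]integral_mkcond.
apply: eq_integral => x _; rewrite patchE.
case: ifPn => xA; first by rewrite in_xsectionX.
by rewrite notin_xsectionX// measure0.
Qed.

Let of_fibersX A : measurable A -> of_fibers (A `*` setT) = lebesgueI A.
Proof.
move=> mA; rewrite of_fibers_setX// -[RHS]mul1e -integral_cst//.
by apply: eq_integral => x _; rewrite probability_setT.
Qed.

Let of_fibers_setT : of_fibers setT = 1%E.
Proof. by rewrite -setXTT of_fibersX// probability_setT. Qed.

HB.instance Definition _ :=
  Measure_isProbability.Build _ _ _ of_fibers of_fibers_setT.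

Lemma of_fibers_fst A : measurable A ->
  pushforward of_fibers fst A = lebesgueI A.
Proof.
move=> mA; rewrite -of_fibersX// /pushforward; congr of_fibers.
by apply/seteqP; split => // x [].
Qed.

Definition leb_of_fibers : leb_measure := LebMeasure of_fibers_fst.

Lemma leb_of_fibersP : disintegrates leb_of_fibers k.
Proof. by split => // A B mA mB; exact: of_fibers_setX. Qed.

End fibers.

(* The fibers of this measure are the convolutions mu^x * nu^x; see
   fiber_convolutionP. *)
Definition fiber_convolution (mu nu : leb_measure) : leb_measure :=
  leb_of_fibers (measurable_convolution
    (measurable_disintegration mu) (measurable_disintegration nu)).

Lemma fiber_convolutionP (mu nu : leb_measure) :
  disintegrates (fiber_convolution mu nu)
    (fun x => convolution (disintegration mu x) (disintegration nu x)).
Proof. exact: leb_of_fibersP. Qed.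

End leb_measure.

Lemma ptws_cvgP (T : Type) (V : topologicalType) (F : set_system (T -> V))
    (g : T -> V) : Filter F ->
  {ptws, F --> g} <-> (forall t, h t @[h --> F] --> g t).
Proof.
move=> FF; rewrite cvg_sup.
have evT t : (@^~ t) @` [set: T -> V] = setT.
  by rewrite eqEsubset; split=> v // _; exists (cst v).
split=> + t => /(_ t).
  rewrite cvg_image// => h W /h [W' FW' <-].
  by apply: (@filterS _ F FF W' _ _ FW') => k W'k /=; exists k.
rewrite cvg_image// => Ft W /Ft FW; exists (@^~ t @^-1` W) => //.
by rewrite eqEsubset; split => [j [? + <-//]|j Wj]; exists (cst j).
Qed.

Lemma leb_cvgP (R : realType) (F : set_system (leb_measure R))
    (mu : leb_measure R) : Filter F ->
  F --> mu <->
  (forall phi : unitI R * circle R -> R, continuous phi ->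
    \int[nu]_z phi z @[nu --> F] --> \int[mu]_z phi z).
Proof.
move=> FF; have -> : F --> mu <->
    {ptws, @leb_eval R @ F --> @leb_eval R mu}.
  split=> [Fmu|Fmu].
    move=> B nB; apply: Fmu.
    exact: (@initial_continuous _ _ (@leb_eval R) mu B nB).
  move=> A [_ [[B oB <-] Bmu sBA]].
  by apply: filterS sBA _; apply: Fmu; exact: open_nbhs_nbhs.
rewrite ptws_cvgP; split=> [h phi cphi|h phi].
  pose p := @isContinuous.Build _ _ phi cphi.
  exact: h (HB.pack_for (continuousType (unitI R * circle R)%type R) phi p).
by apply: h; exact: cts_fun.
Qed.

Section circle_derivative.
Context {R : realType}.
Local Notation I := (unitI R).
Local Notation K := (circle R).

(* Here y ranges over I, so this is a one-sided derivative at 0 and at 1. *)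
Definition is_deriveI (g : I -> R) (x : I) (l : R) : Prop :=
  (g y - g x) / (unitI_val y - unitI_val x) @[y --> x^'] --> l.

(* The derivative at x of f : I -> R/Z, read through a lift F of f. Differentiability
   forces F to be continuous at x, so near x it is f composed with a chart of
   R/Z; any two such lifts differ by a constant near x. Nothing is required of F
   away from x. *)
Definition is_circle_derive (f : I -> K) (x : I) (l : R) : Prop :=
  exists2 F : I -> R, (forall y, circle_pi (F y) = f y) & is_deriveI F x l.

(* f1 and f2 are the first and second derivatives; the continuity of f1 is
   implied. *)
Definition circle_C2 (f : I -> K) : Prop :=
  exists f1 f2 : I -> R,
    [/\ forall x, is_circle_derive f x (f1 x),
        forall x, is_deriveI f1 x (f2 x) &
        continuous f2].

Lemma continuous_unitI_val : continuous (@unitI_val R).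
Proof. exact: initial_continuous. Qed.

Lemma is_deriveI_continuous (g : I -> R) x l :
  is_deriveI g x l -> {for x, continuous g}.
Proof.
move=> dg; apply/continuous_withinNx.
have vx : unitI_val y @[y --> x^'] --> unitI_val x.
  by apply: cvg_within_filter; exact: continuous_unitI_val.
have : (g y - g x) / (unitI_val y - unitI_val x) *
    (unitI_val y - unitI_val x) + g x @[y --> x^'] --> g x.
  rewrite -[X in _ --> X](_ : l * (unitI_val x - unitI_val x) + g x = g x).
    apply: cvgD; last exact: cvg_cst.
    by apply: cvgM => //; apply: cvgB => //; exact: cvg_cst.
  by rewrite subrr mulr0 add0r.
apply: cvg_trans; apply: near_eq_cvg.
near=> y.
have yx : y != x by near: y; exact: nbhs_dnbhs_neq.
rewrite divfK ?subrK//; rewrite subr_eq0; apply: contra yx => /eqP/val_inj ->.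
by [].
Unshelve. all: by end_near. Qed.

Lemma circle_C2_continuous (f : I -> K) : circle_C2 f -> continuous f.
Proof.
move=> [f1 [_ [df _ _]]] x; have [F Ff dF] := df x.
rewrite (_ : f = @circle_pi R \o F); last by apply/funext => y; rewrite /= Ff.
apply: continuous_comp; first exact: is_deriveI_continuous dF.
exact: continuous_circle_pi.
Qed.

Lemma circle_C2_measurable (f : I -> K) : circle_C2 f -> measurable_fun setT f.
Proof.
move=> /circle_C2_continuous/continuousP cf.
apply: (@measurability _ _ I K setT f (@open K)) => //.
by move=> _ [U oU <-]; rewrite setTI; apply: sub_sigma_algebra; exact: cf.
Qed.

Lemma circle_C2_mulz_measurable (f : I -> K) (k : int) :
  circle_C2 f -> measurable_fun setT (fun x => f x *~ k).
Proof.
move=> /circle_C2_measurable mf.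
have mn (n : nat) : measurable_fun setT (fun x => f x *+ n).
  elim: n => [|n IHn]; first by apply: measurable_cst.
  rewrite (_ : (fun x => _) = (fun p : K * K => p.1 + p.2) \o
    (fun x => (f x, f x *+ n))); last by apply/funext => x /=; rewrite mulrS.
  by apply: measurableT_comp; [exact: measurable_circleD|exact: measurable_fun_pair].
case: k => n; first exact: mn.
rewrite (_ : (fun x => _) = @circle_pi R \o (-%R \o
    (@circle_frac R \o (fun x => f x *+ n.+1)))).
  apply: measurableT_comp; first exact: measurable_circle_pi.
  apply: measurableT_comp; first exact: oppr_measurable.
  by apply: measurableT_comp; [exact: measurable_circle_frac|exact: mn].
by apply/funext => x /=; rewrite NegzE mulrNz circle_piN circle_fracK.
Qed.

End circle_derivative.

(* Main.v *)
Require Import Defs.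
From HB Require Import structures.
From mathcomp Require Import all_boot all_order all_algebra.
From mathcomp Require Import all_classical all_reals all_analysis.
From mathcomp Require Import giry measurable_realfun ring lra.
Set Implicit Arguments.
Unset Strict Implicit.
Unset Printing Implicit Defensive.
Import Order.TTheory GRing.Theory Num.Theory.
Import numFieldNormedType.Exports.

Local Open Scope classical_set_scope.
Local Open Scope ring_scope.

(** Let [nu] be the chosen disintegration of [mu] and let [M] be the measure on
    [I * K] with fibers [nu x]. The measure [D_(kf) * mu] is the image of [M] by
    the shear [(x, y) |-> (x, k f(x) + y)] ([fiber_convolution_graph]), and
    [lambda] is the image of [M \x haar] by [((x, y), z) |-> (x, z + y)],
    because Haar measure absorbs the translation by [y]
    ([leb_haar_pushforward]). So the claim is that, against a continuous [phi],
    the deterministic point [z = k f(x)] may be replaced in the limit by a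
    uniform [z] independent of [(x, y)].

    By compactness, [phi (x, z + y)] is uniformly close to a finite sum
    [\sum_j psi_j z * a_j (x, y)], where the [psi_j] are a continuous partition
    of unity of the circle ([separate_shift]). For one term, integrating [a_j]
    over the fibers of [M] leaves a bounded measurable function [c] of [x], and
    one needs that [\int c x * psi (k f x)] tends to
    [\int c * \int psi dhaar] ([fiber_equidistribution]).

    This is a lemma of Riemann-Lebesgue type. Approximating [c] in L1 by a
    function of class C1, one may integrate by parts. If [Psi] is a primitive
    on the circle of [psi] minus its mean, then
      [d/dx (Psi (k f x)) = k * f' x * (psi (k f x) - mean)],
    so that, [f'] being nonzero and of class C1, the integral of
    [v x * (psi (k f x) - mean)] equals [1/k] times a boundary term and the
    integral of [(v / f')' x * Psi (k f x)], which are bounded uniformly in [k]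
    ([C1_oscillation]). The chain rule at [x] uses only a lift of [f] near [x],
    so no global lift of [f] to the real line has to be constructed. *)

(** * Measures with given fibers, and their images *)

Section fiber_integral.
Context {R : realType}.
Local Notation I := (unitI R).
Local Notation K := (circle R).
Variables (k : I -> pprobability K R) (mk : measurable_fun setT k).

(* The image of [k x] on the line [{x} * K]; the bind of the Giry monad glues
   these measures into [leb_of_fibers]. *)
Let fiber (x : I) : giry (I * K)%type R :=
  giry_map (pair1_measurable x : measurable_fun setT (pair x : K -> I * K))
    ((k x : probability K R) : giry K R).

Let measurable_fiber : measurable_fun setT fiber.
Proof.
apply: measurable_giry_codensity => // B mB.
rewrite (_ : (fun x => _) = (fun x => k x (xsection B x))); last first.
  by apply/funext => x; rewrite xsectionE.
apply: (measurable_fun_xsection_finite_kernel (kprobability mk)).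
exact: mem_set.
Qed.

Let bind_fiber (A : set (I * K)) : measurable A ->
  giry_bind (@lebesgueI R : giry I R) measurable_fiber A = leb_of_fibers mk A.
Proof.
move=> mA; rewrite /giry_bind /= giry_int_map//; last exact: measurable_giry_ev.
by apply: eq_integral => x _; rewrite xsectionE.
Qed.

(** Tonelli's theorem for a kernel: [leb_of_fibers] is a bind in the Giry monad,
    and integrals against a bind are iterated integrals. *)
Lemma ge0_integral_leb_of_fibers (h : I * K -> \bar R) :
  measurable_fun setT h -> (forall p, 0 <= h p)%E ->
  (\int[leb_of_fibers mk]_p h p = \int[lebesgueI]_x \int[k x]_y h (x, y))%E.
Proof.
move=> mh h0; transitivity (giry_int
  (giry_bind (@lebesgueI R : giry I R) measurable_fiber) h).
  rewrite /giry_int; apply: eq_measure_integral => A mA _.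
  exact/esym/bind_fiber.
rewrite giry_int_bind//; apply: eq_integral => x _.
by rewrite giry_int_map.
Qed.

End fiber_integral.

(** Rectangles form a pi-system that generates the product sigma-algebra. *)
Lemma measure_eq_setX d1 d2 (T1 : measurableType d1) (T2 : measurableType d2)
    (R : realType) (m1 m2 : {measure set (T1 * T2) -> \bar R}) :
  (m1 setT < +oo)%E ->
  (forall A B, measurable A -> measurable B -> m1 (A `*` B) = m2 (A `*` B)) ->
  forall C, measurable C -> m1 C = m2 C.
Proof.
move=> m1fin m12; apply: (measure_unique
    [set A `*` B | A in measurable & B in measurable] (fun=> setT)) => //.
- exact: measurable_prod_measurableType.
- move=> _ _ [A1 mA1 [B1 mB1 <-]] [A2 mA2 [B2 mB2 <-]].
  exists (A1 `&` A2); first exact: measurableI.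
  exists (B1 `&` B2); first exact: measurableI.
  by rewrite setXI.
- by move=> _; exists setT => //; exists setT => //; rewrite setXTT.
- by apply/seteqP; split => // x _; exists 0%N.
- by move=> _ [A mA [B mB <-]]; exact: m12.
Qed.

Section pushforwards.
Context {R : realType}.
Local Notation I := (unitI R).
Local Notation K := (circle R).

Lemma measurable_circle_shift (g : I -> K) : measurable_fun setT g ->
  measurable_fun setT (fun p : I * K => g p.1 + p.2).
Proof.
move=> mg; rewrite (_ : (fun p => _) =
    (fun q : K * K => q.1 + q.2) \o (fun p : I * K => (g p.1, p.2)))//.
apply: measurableT_comp; first exact: measurable_circleD.
apply: measurable_fun_pair => //.
exact: measurableT_comp.
Qed.

Lemma measurable_shear (g : I -> K) : measurable_fun setT g ->
  measurable_fun setT (fun p : I * K => (p.1, g p.1 + p.2)).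
Proof.
by move=> mg; apply: measurable_fun_pair => //; exact: measurable_circle_shift.
Qed.

Lemma measurable_shift_snd :
  measurable_fun setT (fun q : (I * K) * K => (q.1.1, q.2 + q.1.2)).
Proof.
apply: measurable_fun_pair => /=; first exact: measurableT_comp.
rewrite (_ : (fun p => _) =
  (fun q : K * K => q.1 + q.2) \o (fun p : (I * K) * K => (p.2, p.1.2)))//.
apply: measurableT_comp; first exact: measurable_circleD.
by apply: measurable_fun_pair => //; exact: measurableT_comp.
Qed.

(** The Dirac masses at [g x] disintegrate the graph measure, so the choice made
    in [disintegration] succeeds. *)
Lemma graph_measure_disintegration (g : I -> K) (mg : measurable_fun setT g) :
  disintegrates (graph_measure mg) (disintegration (graph_measure mg)).
Proof.
apply: (@getPex _ [set k | disintegrates (graph_measure mg) k]).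
exists (fun x => \d_(g x) : probability K R); split.
  apply: measurable_pprobability => B mB.
  exact: (measurableT_comp (measurable_fun_dirac mB) mg).
move=> A B mA mB.
transitivity (lebesgueI (A `&` g @^-1` B)); first by [].
have mgB : measurable (g @^-1` B).
  by rewrite -[X in measurable X]setTI; exact: mg.
by rewrite setIC -integral_indic.
Qed.

(** Only the measure built from the chosen disintegration of the graph measure
    enters, not its fibers: with [F (x, z)] the mass that [nu x] gives to the
    translate by [- z] of the slice of [A] over [x], both sides are the integral
    of [F] against the graph measure. *)
Lemma fiber_convolution_graph (g : I -> K) (mg : measurable_fun setT g)
    (nu : leb_measure R) (A : set (I * K)) : measurable A ->
  fiber_convolution (graph_measure mg) nu A =
  pushforward (leb_of_fibers (measurable_disintegration nu))
    (fun p => (p.1, g p.1 + p.2)) A.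
Proof.
move=> mA.
set kg := disintegration (graph_measure mg).
set kn := disintegration nu.
have [mkg gkg] := graph_measure_disintegration mg.
pose F (p : I * K) :=
  kn p.1 (xsection [set q : (I * K) * K | A (q.1.1, q.1.2 + q.2)] p).
have mF : measurable_fun setT F.
  have mkn : measurable_fun setT (kn \o fst : I * K -> pprobability K R).
    by apply: measurableT_comp => //; exact: measurable_disintegration.
  apply: (measurable_fun_xsection_finite_kernel (kprobability mkn)).
  apply: mem_set; rewrite -[X in measurable X]setTI.
  have /(_ measurableT _ mA) : measurable_fun setT
      (fun q : (I * K) * K => (q.1.1, q.1.2 + q.2)) => //.
  rewrite (_ : (fun q => _) = (fun q : (I * K) * K => (q.1.1, q.2 + q.1.2)))//.
    exact: measurable_shift_snd.
  by apply/funext => q; rewrite addrC.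
transitivity (\int[lebesgueI]_x \int[kg x]_z F (x, z))%E.
  apply: eq_integral => x _.
  apply: eq_integral => z _ /=.
  rewrite /F /=; congr (kn x _).
  by rewrite !xsectionE.
rewrite -(ge0_integral_leb_of_fibers
  (measurable_disintegration (graph_measure mg)))//.
transitivity (\int[graph_measure mg]_p F p)%E.
  apply: eq_measure_integral => B mB _.
  apply: measure_eq_setX => //;
    first by rewrite (le_lt_trans (probability_le1 _ _))// ltry.
  move=> C D mC mD; have [_ h] :=
    leb_of_fibersP (measurable_disintegration (graph_measure mg)).
  by rewrite [LHS]h// [RHS]gkg.
by rewrite ge0_integral_pushforward.
Qed.

(** For every [p], translating by [p.2] does not change Haar measure, so the
    image measure has the right value on rectangles. *)
Lemma leb_haar_pushforward (mu : leb_measure R) (A : set (I * K)) :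
    measurable A ->
  leb_haar R A = pushforward_prob (mu \x haar)%E measurable_shift_snd A.
Proof.
apply: product_measure_unique => B C mB mC.
transitivity (\int[mu]_p (haar C * (\1_(B `*` setT) p)%:E))%E.
  apply: eq_integral => p _ /=; rewrite indicE.
  have [pB|pB] := boolP (p \in B `*` setT).
    rewrite mule1; apply: etrans (haar_shift p.2 mC).
    congr (lebesgueI (_ @^-1` _)).
    rewrite xsectionE; apply/seteqP; split => z /=; first by case.
    by move=> Cz; split => //; move: pB; rewrite inE => -[].
  rewrite mule0 (_ : xsection _ _ = set0) ?measure0//.
  rewrite xsectionE; apply/seteqP; split => // z /= [Bp _].
  by move: pB; rewrite notin_setE => -[].
rewrite ge0_integralZl//; last first.
  by apply/measurable_EFinP/measurable_indic; exact: measurableX.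
rewrite integral_indic//; last exact: measurableX.
rewrite muleC setIT; congr (_ * _)%E; apply: etrans (leb_fst mu mB).
congr (leb_prob mu _); by apply/seteqP; split => // -[x y] [].
Qed.

End pushforwards.

Section bounded.
Context d (T : measurableType d) (R : realType) (P : probability T R).

Lemma bounded_integrable (h : T -> R) (M : R) : measurable_fun setT h ->
  (forall x, `|h x| <= M) -> P.-integrable setT (EFin \o h).
Proof.
move=> mh hM; apply: measurable_bounded_integrable => //.
  by rewrite (le_lt_trans (probability_le1 _ _))// ltry.
exists M; split; first exact: num_real.
by move=> y My x _; exact: le_trans (hM x) (ltW My).
Qed.

Lemma ge0_integral_pushforward_prob d' (T' : measurableType d') (g : T -> T')
    (mg : measurable_fun setT g) (h : T' -> \bar R) :
  measurable_fun setT h -> (forall x, 0 <= h x)%E ->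
  (\int[pushforward_prob P mg]_y h y = \int[P]_x h (g x))%E.
Proof. by move=> mh h0; apply: (ge0_integral_pushforward mg). Qed.

Lemma Rintegral_pushforward_prob d' (T' : measurableType d') (g : T -> T')
    (mg : measurable_fun setT g) (h : T' -> R) (M : R) :
  measurable_fun setT h -> (forall x, `|h x| <= M) ->
  \int[pushforward_prob P mg]_y h y = \int[P]_x h (g x).
Proof.
move=> mh hM; congr fine; apply: (integral_pushforward mg) => //.
  exact/measurable_EFinP.
rewrite preimage_setT; apply: (@bounded_integrable (h \o g) M) => [|x].
  exact: measurableT_comp mh mg.
exact: hM.
Qed.

End bounded.

(** * Charts of the interval and of the circle; compactness *)

Section charts.
Context {R : realType}.
Local Notation I := (unitI R).
Local Notation K := (circle R).

Let clamp_subproof (t : R) :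
  Num.min 1 (Num.max 0 t) \in `[0 : R, 1 : R]%classic.
Proof.
by rewrite inE/= in_itv/= ge_min lexx/= andbT le_min ler01/= le_max lexx.
Qed.

(** A retraction of the line onto the interval, defined and continuous
    everywhere: composing with it turns functions on [I] into functions on the
    line. *)
Definition clampI (t : R) : I :=
  exist _ (Num.min 1 (Num.max 0 t)) (clamp_subproof t).

Lemma clampI_val (t : R) : 0 <= t <= 1 -> unitI_val (clampI t) = t.
Proof. by move=> /andP[t0 t1]; rewrite /unitI_val/= max_r// min_r. Qed.

Lemma clampIK : cancel (@unitI_val R) clampI.
Proof.
move=> x; apply: val_inj; apply: clampI_val.
by have := unitI_val_itv x; rewrite in_itv.
Qed.

Lemma continuous_clampI : continuous clampI.
Proof.
apply: continuous_comp_initial.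
suff : continuous ((cst 1 : R -> R^o) \min ((cst 0 : R -> R^o) \max id)) by [].
move=> t; apply: continuous_min; first exact: cst_continuous.
by apply: continuous_max; [exact: cst_continuous|exact: cvg_id].
Qed.

Lemma continuous_circle (T : topologicalType) (h : K -> T) :
  continuous (h \o @circle_pi R) -> continuous h.
Proof. by move=> /continuousP ch; apply/continuousP => A /ch. Qed.

(** Hence [g \o circle_frac] is the function that a 1-periodic [g] induces on the
    circle. *)
Lemma circle_fracE (T : Type) (g : R -> T) (t : R) :
  (forall s, g (s + 1) = g s) -> g (circle_frac (circle_pi t)) = g t.
Proof.
move=> g1.
have gn (n : nat) s : g (s + n%:R) = g s.
  by elim: n s => [|n IHn] s; rewrite ?addr0// -addn1 natrD addrA g1 IHn.
have /circle_pi_eq/intrP[[n|n] /eqP] := circle_fracK (circle_pi t);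
  rewrite subr_eq => /eqP ->; first by rewrite addrC gn.
by rewrite NegzE -(gn n.+1) mulrNz addrAC addNr add0r.
Qed.

Lemma compact_circle : compact [set: K].
Proof.
rewrite (_ : setT = @circle_pi R @` `[0, 1]); last first.
  apply/seteqP; split => // z _; exists (circle_frac z);
    last exact: circle_fracK.
  by rewrite /= in_itv/=; have /andP[-> /ltW ->] := circle_frac_itv z.
apply: continuous_compact; last exact: segment_compact.
exact/continuous_subspaceT/continuous_circle_pi.
Qed.

Lemma compact_unitI : compact [set: I].
Proof.
rewrite (_ : setT = clampI @` `[0, 1]); last first.
  apply/seteqP; split => // x _; exists (unitI_val x); last exact: clampIK.
  exact: unitI_val_itv.
apply: continuous_compact; last exact: segment_compact.
exact/continuous_subspaceT/continuous_clampI.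
Qed.

Lemma compact_continuous_bounded (T : topologicalType) (h : T -> R) :
  compact [set: T] -> continuous h -> exists M, forall x, `|h x| <= M.
Proof.
move=> cT ch.
have /compact_bounded[M [_ hM]] : compact (h @` setT).
  by apply: continuous_compact => //; exact: continuous_subspaceT.
exists (M + 1) => x; apply: hM; first by rewrite ltrDl.
by exists x.
Qed.

Lemma continuous_pair (T U V : topologicalType) (g : T -> U) (h : T -> V) :
  continuous g -> continuous h -> continuous (fun x => (g x, h x)).
Proof. by move=> cg ch x; exact: (cvg_pair (cg x) (ch x)). Qed.

(** Near covering of the compact set of representatives in [[0, 1] * [0, 1]]
    turns continuity at each point into a bound uniform in the point. *)
Lemma circle_shift_unif (phi : I * K -> R) (e : R) : continuous phi -> 0 < e ->
  exists2 d, 0 < d & forall u p, `|u| < d ->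
    `|phi (p.1, p.2 + circle_pi u) - phi p| < e.
Proof.
move=> cphi e0.
pose Phi (q : (R * R) * R) := phi (clampI q.1.1, circle_pi (q.1.2 + q.2)).
have cPhi : continuous Phi.
  have c1 : continuous (fun q : (R * R) * R => q.1.1).
    by move=> q; apply: continuous_comp; exact: cvg_fst.
  have c2 : continuous (fun q : (R * R) * R => q.1.2).
    by move=> q; apply: continuous_comp; [exact: cvg_fst|exact: cvg_snd].
  have c3 : continuous (fun q : (R * R) * R =>
      (clampI q.1.1, circle_pi (q.1.2 + q.2))).
    apply: continuous_pair => q.
      apply: (@continuous_comp _ _ _ (fun q : (R * R) * R => q.1.1) clampI).
        exact: c1.
      exact: continuous_clampI.
    have c4 : {for q, continuous (fun q : (R * R) * R => q.1.2 + q.2)}.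
      by apply: cvgD; [exact: c2|exact: cvg_snd].
    apply: (@continuous_comp _ _ _
      (fun q : (R * R) * R => q.1.2 + q.2) (@circle_pi R)) => //.
    exact: continuous_circle_pi.
  by move=> q; exact: (@continuous_comp _ _ _ (fun q : (R * R) * R =>
      (clampI q.1.1, circle_pi (q.1.2 + q.2))) phi q (c3 q) (cphi _)).
have /compact_near_coveringP : compact (`[0 : R, 1] `*` `[0 : R, 1]).
  by apply: compact_setX; exact: segment_compact.
move=> /(_ R (nbhs 0) (fun u st => `|Phi (st, u) - Phi (st, 0)| < e)).
case.
  move=> st _.
  have e2 : 0 < e / 2 by rewrite divr_gt0.
  have h1 : \forall q \near (st, 0 : R), `|Phi (st, 0) - Phi q| < e / 2.
    by have /cvgrPdist_lt/(_ _ e2) := cPhi (st, 0).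
  have h2 : \forall q \near (st, 0 : R), `|Phi (st, 0) - Phi (q.1, 0)| < e / 2.
    have /cvgrPdist_lt/(_ _ e2) : Phi (q.1, 0) @[q --> (st, 0 : R)] -->
        Phi (st, 0).
      have c5 : continuous (fun q : (R * R) * R => (q.1, 0 : R)).
        by apply: continuous_pair => q; [exact: cvg_fst|exact: cvg_cst].
      exact: (@continuous_comp _ _ _ (fun q : (R * R) * R => (q.1, 0)) Phi
        (st, 0) (c5 _) (cPhi _)).
    by [].
  near=> q; rewrite /= -surjective_pairing.
  have a1 : `|Phi (st, 0) - Phi q| < e / 2 by near: q.
  have a2 : `|Phi (st, 0) - Phi (q.1, 0)| < e / 2 by near: q.
  move: a1 a2; rewrite distrC => a1 a2.
  rewrite -[X in `|X|](subrKA (Phi (st, 0))) (le_lt_trans (ler_normD _ _))//.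
  by rewrite (splitr e) ltrD.
move=> d/= d0 hd; exists d => // u [x z] ud /=.
have := hd u; rewrite /ball/= sub0r normrN =>
    /(_ ud (unitI_val x, circle_frac z)).
rewrite /Phi/= clampIK addr0 circle_piD circle_fracK; apply.
split; first exact: unitI_val_itv.
by rewrite /= in_itv/=; have /andP[-> /ltW ->] := circle_frac_itv z.
Unshelve. all: by end_near. Qed.

End charts.

(** * A partition of unity of the circle *)

Section partition_of_unity.
Context {R : realType}.
Local Notation I := (unitI R).
Local Notation K := (circle R).

(** Positive exactly on the arc of radius [d] around 0, for
    [0 < d <= 1/2]; the cosine makes periodicity and continuity immediate. *)
Definition circle_bump (d : R) (z : K) : R :=
  Num.max 0 (cos (2 * pi * circle_frac z) - cos (2 * pi * d)).

Lemma circle_bump_pi (d t : R) : circle_bump d (circle_pi t) =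
  Num.max 0 (cos (2 * pi * t) - cos (2 * pi * d)).
Proof.
rewrite /circle_bump; congr (Num.max 0 (_ - _)).
apply: (circle_fracE (g := fun t => cos (2 * pi * t))) => s.
by rewrite mulrDr mulr1 [2 * pi]mulr_natl cosD2pi.
Qed.

Lemma continuous_circle_bump (d : R) : continuous (circle_bump d).
Proof.
apply: continuous_circle.
rewrite (_ : _ \o _ = (cst 0 : R -> R^o) \max
    (fun t => cos (2 * pi * t) - cos (2 * pi * d))); last first.
  by apply/funext => t; rewrite /= circle_bump_pi.
move=> t; apply: continuous_max; first exact: cst_continuous.
apply: (@continuousB _ _ _ (fun t => cos (2 * pi * t)) (cst _));
  last exact: cst_continuous.
apply: (@continuous_comp _ _ _ (fun t => 2 * pi * t) cos);
  last exact: continuous_cos.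
exact: mulrl_continuous.
Qed.

Let cos_near (d u : R) : 0 < d <= 2^-1 -> `|u| <= 2^-1 ->
  (cos (2 * pi * d) < cos (2 * pi * u)) = (`|u| < d).
Proof.
move=> /andP[d0 d1] u1; have p0 := pi_gt0 R.
rewrite (_ : cos (2 * pi * u) = cos (2 * pi * `|u|)); last first.
  by have [_|_] := ger0P u; rewrite ?mulrN ?cosN.
have h (x : R) : 0 <= x <= 2^-1 -> 2 * pi * x \in `[0, pi].
  move=> /andP[x0 x1]; rewrite in_itv/= !mulr_ge0 ?pi_ge0//=.
  rewrite mulrAC ger_pMl//; lra.
by rewrite ltr_cos ?h ?(ltW d0) ?normr_ge0// ltr_pM2l// mulr_gt0.
Qed.

Lemma circle_bump_gt0 (d u : R) : 0 < d <= 2^-1 -> `|u| < d ->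
    0 < circle_bump d (circle_pi u).
Proof.
move=> d01 ud; rewrite circle_bump_pi lt_max subr_gt0 cos_near ?ud ?orbT//.
by rewrite (le_trans (ltW ud)); have /andP[] := d01.
Qed.

Lemma circle_bump_neq0 (d : R) (z : K) : 0 < d <= 2^-1 ->
    circle_bump d z != 0 ->
  exists2 u, `|u| < d & z = circle_pi u.
Proof.
move=> d01 bz.
have [u u2 zu] : exists2 u, `|u| <= 2^-1 & z = circle_pi u.
  have /andP[z0 z1] := circle_frac_itv z.
  have [z2|z2] := leP (circle_frac z) 2^-1.
    by exists (circle_frac z); [rewrite ger0_norm|rewrite circle_fracK].
  exists (circle_frac z - 1).
    by rewrite ler_norml; apply/andP; split; lra.
  rewrite -[LHS]circle_fracK; apply/circle_pi_eq.
  by rewrite opprB addrC subrK; exact: intr_int 1.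
exists u => //; move: bz; rewrite zu circle_bump_pi.
have [h|h _] := leP (cos (2 * pi * u) - cos (2 * pi * d)) 0.
  by rewrite eqxx.
by rewrite -cos_near// -subr_gt0.
Qed.

(** The translates of a bump of radius [d] centred at the multiples of [1/N],
    with [1/N < d], have a positive sum; divide by it. *)
Lemma partition_of_unity (d : R) : 0 < d ->
  exists (N : nat) (t : 'I_N -> K) (psi : 'I_N -> K -> R),
  [/\ forall j, continuous (psi j), forall j z, 0 <= psi j z,
      forall z, \sum_j psi j z = 1 &
      forall j z, psi j z != 0 -> exists2 u, `|u| < d & z = t j + circle_pi u].
Proof.
move=> d0; pose c := Num.min d 2^-1.
have c0 : 0 < c <= 2^-1 by rewrite lt_min d0 invr_gt0 ltr0n/= ge_min lexx orbT.
have cd : c <= d by rewrite ge_min lexx.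
have [n nc] : exists n : nat, c^-1 < n.+1%:R.
  exists (Num.truncn c^-1); exact: truncnS_gt.
pose t (j : 'I_n.+1) : K := circle_pi (j%:R / n.+1%:R).
pose b (j : 'I_n.+1) (z : K) : R := circle_bump c (z - t j).
pose S (z : K) : R := \sum_j b j z.
have b0 j z : 0 <= b j z by rewrite /b /circle_bump le_max lexx.
have S0 z : 0 < S z.
  have /andP[z0 z1] := circle_frac_itv z.
  have n0 : 0 < n.+1%:R :> R by rewrite ltr0n.
  (* the node just below [circle_frac z] is at distance less than [c] *)
  pose m := Num.truncn (circle_frac z * n.+1%:R).
  have /andP[m1 m2] : m%:R <= circle_frac z * n.+1%:R < m.+1%:R.
    by apply: truncn_itv; rewrite mulr_ge0.
  have mn : (m < n.+1)%N.
    by rewrite -(ltr_nat R) (le_lt_trans m1)// gtr_pMl.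
  rewrite /S (bigD1 (Ordinal mn))//= ltr_pwDl ?sumr_ge0//.
  rewrite /b -[z in circle_bump _ (z - _)]circle_fracK -circle_piN -circle_piD.
  apply: circle_bump_gt0 => //=; rewrite ger0_norm ?subr_ge0 ?ler_pdivrMr//.
  rewrite ltrBlDr -(ltr_pM2r n0) [X in _ < X]mulrDl divfK ?gt_eqF//.
  apply: (lt_trans m2); rewrite -natr1 addrC ltrD2r.
  by have /andP[c0' _] := c0; rewrite -ltr_pdivrMl// mulr1.
exists n.+1, t, (fun j z => b j z / S z); split.
- have cb j : continuous (b j).
    apply: continuous_circle => s.
    have -> : b j \o @circle_pi R = circle_bump c \o
        (@circle_pi R \o (fun s => s - j%:R / n.+1%:R)).
      by apply/funext => r; rewrite /b/= circle_piD circle_piN.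
    apply: continuous_comp; last exact: continuous_circle_bump.
    apply: continuous_comp; last exact: continuous_circle_pi.
    by apply: cvgB; [exact: cvg_id|exact: cvg_cst].
  have cS : continuous S.
    by apply: continuous_big => [|j _]; [exact: add_continuous|exact: cb].
  move=> j z; apply: (@continuousM _ _ (b j) (fun z => (S z)^-1));
    first exact: cb.
  have Sz : S z != 0 by rewrite gt_eqF.
  exact: (continuousV Sz (cS z)).
- by move=> j z; rewrite divr_ge0// ltW.
- by move=> z; rewrite -mulr_suml; apply: divff; rewrite gt_eqF //; exact: S0.
- move=> j z; rewrite mulf_eq0 negb_or => /andP[/circle_bump_neq0 h _].
  have [u uc /eqP] := h c0; rewrite subr_eq addrC => /eqP zu.
  by exists u => //; exact: lt_le_trans cd.
Qed.

(** Variables [z] and [(x, y)] are separated by freezing [z] at the centre [t j]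
    of the arc that supports [psi j]; the error is an average of increments of
    [phi] under small rotations. *)
Lemma separate_shift (phi : I * K -> R) (e : R) : continuous phi -> 0 < e ->
  exists (N : nat) (t : 'I_N -> K) (psi : 'I_N -> K -> R),
  [/\ forall j, continuous (psi j), forall j z, 0 <= psi j z &
      forall x z y, `|phi (x, z + y) - \sum_j psi j z * phi (x, t j + y)| <= e].
Proof.
move=> cphi e0; have [d d0 dphi] := circle_shift_unif cphi e0.
have [N [t [psi [cpsi psi0 psi1 psit]]]] := partition_of_unity d0.
exists N, t, psi; split => // x z y.
rewrite -[phi _]mul1r -(psi1 z) mulr_suml -sumrB.
rewrite (le_trans (ler_norm_sum _ _ _))// -[leRHS]mul1r -(psi1 z) mulr_suml.
apply: ler_sum => j _; rewrite -mulrBr normrM (ger0_norm (psi0 _ _)).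
have [->|/psit[u ud ->]] := eqVneq (psi j z) 0; first by rewrite !mul0r.
rewrite ler_wpM2l// ltW//.
by rewrite addrAC; have := dphi u (x, t j + y) ud.
Qed.

Lemma continuous_measurable_circle (h : K -> R) : continuous h ->
    measurable_fun setT h.
Proof.
move=> /continuousP ch; apply: (measurability _ (RGenOpens.measurableE R)).
move=> _ [_ [a [b ->] <-]]; rewrite setTI.
by apply: open_measurable_circle; apply: ch; exact: itv_open.
Qed.

Lemma continuous_measurable_unitI (h : I -> R) : continuous h ->
    measurable_fun setT h.
Proof.
move=> /continuousP ch; apply: (measurability _ (RGenOpens.measurableE R)).
move=> _ [_ [a [b ->] <-]]; rewrite setTI.
by apply: sub_sigma_algebra; apply: ch; exact: itv_open.
Qed.

(** The sigma-algebra on [I * K] is generated by rectangles, so continuity does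
    not give measurability at once; [separate_shift] with [y = 0] writes [phi]
    as a uniform limit of sums of products of continuous functions of one
    variable. *)
Lemma continuous_measurable_prod (phi : I * K -> R) :
  continuous phi -> measurable_fun setT phi.
Proof.
move=> cphi.
have h n : exists g : I * K -> R, measurable_fun setT g /\
    forall p, `|phi p - g p| <= n.+1%:R^-1.
  have e0 : 0 < n.+1%:R^-1 :> R by rewrite invr_gt0.
  have [N [t [psi [cpsi _ apx]]]] := separate_shift cphi e0.
  exists (fun p => \sum_j psi j p.2 * phi (p.1, t j)); split; last first.
    move=> [x z]; have := apx x z 0; rewrite addr0.
    by under eq_bigr do rewrite addr0.
  apply: measurable_sum => j; apply: measurable_funM.
    by apply: measurableT_comp => //; exact: continuous_measurable_circle.
  apply: (@measurableT_comp _ _ _ _ _ _ (fun x => phi (x, t j)) _ fst) => //.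
  apply: continuous_measurable_unitI => x.
  have c : continuous (fun x : I => (x, t j)).
    by apply: continuous_pair => ?; [exact: cvg_id|exact: cst_continuous].
  exact: (@continuous_comp _ _ _ (fun x => (x, t j)) phi x (c x) (cphi _)).
have [g hg] := choice h.
apply: (@measurable_fun_cvg _ _ _ _ g) => //.
  by move=> n; have [] := hg n.
move=> p _; apply/cvgrPdist_le => e e0.
have := near_infty_natSinv_lt (PosNum e0).
apply: filterS => n /= ne; have [_ /(_ p)] := hg n.
by move=> /le_trans; apply; exact: ltW.
Qed.

End partition_of_unity.

(** * Primitives of continuous functions *)

Section antiderivative.
Context {R : realType}.
Implicit Types g : R -> R.
Notation leb := (@lebesgue_measure R).

Lemma is_derive_continuous (F dF : R -> R) :
  (forall t : R, is_derive t (1 : R) F (dF t)) -> continuous F.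
Proof.
move=> dF' t; apply/differentiable_continuous/derivable1_diffP.
by have [] := dF' t.
Qed.

Let integrable_itv g (a b : R) : continuous g ->
  leb.-integrable `[a, b] (EFin \o g).
Proof.
move=> cg; apply: continuous_compact_integrable; first exact: segment_compact.
exact: continuous_subspaceT.
Qed.

(* This allows the base point of a primitive to be moved. *)
Let int_base g (a b c x : R) : continuous g -> a <= b -> b <= x -> b <= c ->
  \int[leb]_(t in `[a, x]) g t - \int[leb]_(t in `[a, c]) g t =
  \int[leb]_(t in `[b, x]) g t - \int[leb]_(t in `[b, c]) g t.
Proof.
move=> cg ab bx bc.
have h y : b <= y -> \int[leb]_(t in `[a, y]) g t =
    \int[leb]_(t in `[b, y]) g t + \int[leb]_(t in `[a, b]) g t.
  move=> yb; apply/eqP; rewrite -subr_eq; apply/eqP.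
  rewrite (@Rintegral_itvB _ g (BLeft a) (BRight y) b) ?bnd_simp//;
    last exact: integrable_itv.
  apply: Rintegral_itv_obnd_cbnd.
  apply: integrableS (integrable_itv b y cg) => //.
  exact: subset_itv_oc_cc.
by rewrite (h x)// (h c)// opprD addrACA subrr addr0.
Qed.

(** Integrals from a base point are differentiable only to its right, so the
    base point [- (|x| + 1)] moves with [x]; normalising the value at 0 makes
    these local primitives agree. *)
Lemma continuous_antiderivative g : continuous g ->
  exists G : R -> R, forall x : R, is_derive x (1 : R) G (g x).
Proof.
move=> cg; pose A (a x : R) : R := \int[leb]_(t in `[- a, x]) g t.
pose G (x : R) : R := A (`|x| + 1) x - A (`|x| + 1) 0.
have GE (a x : R) : `|x| + 1 <= a -> G x = A a x - A a 0.
  move=> xa; rewrite /G /A [RHS](@int_base g _ (- (`|x| + 1)))//.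
  - by rewrite lerN2.
  - by rewrite lerNl (le_trans (ler_norm _))// normrN lerDl.
exists G => x; pose a : R := `|x| + 2.
have [dA A'] : derivable (A a) x 1 /\ derive1 (A a) x = g x.
  apply: (@continuous_FTC1_closed R g (- a) x (x + 1)); rewrite ?ltrDl//.
  - exact: integrable_itv.
  - by rewrite ltrNl (le_lt_trans (ler_norm _))// normrN ltrDl.
  - exact: cg.
have dG : is_derive x (1 : R) (fun y => A a y - A a 0) (g x).
  have h : is_derive x (1 : R) (A a) (g x).
    by apply: DeriveDef => //; rewrite -derive1E.
  by rewrite -[g x]subr0; apply: is_deriveB.
apply: near_eq_is_derive dG.
near=> y; apply/esym/GE.
have : ball x 1 y by near: y; apply: nbhsx_ballx; exact: ltr01.
rewrite /ball/= distrC => xy; rewrite /a -[y](subrK x).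
have := ler_normD (y - x) x; lra.
Unshelve. all: by end_near. Qed.

End antiderivative.

(** * From the unit interval and the circle to the real line *)

Section unitI_transfer.
Context {R : realType}.
Local Notation I := (unitI R).
Local Notation K := (circle R).
Notation leb := (@lebesgue_measure R).

Lemma measurable_clampI : measurable_fun setT (@clampI R).
Proof.
apply: (measurability (@open I)) => //.
move=> _ [U oU <-]; rewrite setTI; apply: open_measurable.
by have /continuousP := @continuous_clampI R; exact.
Qed.

(** [lebesgueI] is the image of the uniform probability on [[0, 1]] by the
    retraction [clampI]. *)
Lemma integral_lebesgueI (h : I -> \bar R) : measurable_fun setT h ->
  (\int[lebesgueI]_x h x = \int[leb]_(t in `[0%R, 1%R]) h (clampI t))%E.
Proof.
pose U : probability (measurableTypeR R) R := uniform_prob (@ltr01 R).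
have ge0 (g : I -> \bar R) : measurable_fun setT g -> (forall x, 0 <= g x)%E ->
    (\int[lebesgueI]_x g x = \int[leb]_(t in `[0%R, 1%R]) g (clampI t))%E.
  move=> mg g0; transitivity (\int[pushforward_prob U measurable_clampI]_x g
    x)%E.
    apply: eq_measure_integral => A mA _.
    transitivity (uniform_prob ltr01 (@clampI R @^-1` A)); last by [].
    rewrite /uniform_prob integral_uniform_pdf.
    rewrite (eq_integral (cst 1%E)); last first.
      move=> t; rewrite inE => -[_]; rewrite /= in_itv/= /uniform_pdf => ->.
      by rewrite subr0 invr1.
    have mcA : measurable (@clampI R @^-1` A).
      by rewrite -[X in measurable X]setTI; exact: measurable_clampI.
    rewrite integral_cst ?mul1e//; last exact: measurableI.
    congr (lebesgue_measure _); apply/seteqP; split => [_ [x Ax <-]|t [At t01]].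
      by split; [rewrite /= clampIK|exact: unitI_val_itv].
    by exists (clampI t) => //; apply: clampI_val; move: t01; rewrite /= in_itv.
  rewrite ge0_integral_pushforward_prob// integral_uniform//.
    by rewrite subr0 invr1 mul1e.
  exact: measurableT_comp mg measurable_clampI.
move=> mh; rewrite integralE [RHS]integralE.
rewrite ge0; [|exact: measurable_funepos|by []].
rewrite ge0//; last exact: measurable_funeneg.
by congr (_ - _)%E; apply: eq_integral => t _; rewrite ?funeposE ?funenegE.
Qed.

Lemma Rintegral_lebesgueI (h : I -> R) : measurable_fun setT h ->
  \int[lebesgueI]_x h x = \int[leb]_(t in `[0, 1]) h (clampI t).
Proof.
by move=> mh; rewrite /Rintegral integral_lebesgueI//; exact/measurable_EFinP.
Qed.

(** At an interior point the retraction is the identity nearby, so the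
    difference quotients coincide. *)
Lemma is_deriveI_clamp (g : I -> R) (t l : R) : 0 < t < 1 ->
  is_deriveI g (clampI t) l -> is_derive t (1 : R) (g \o clampI) l.
Proof.
move=> /andP[t0 t1] dg.
have t01 : \forall h \near (0 : R), 0 <= h + t <= 1.
  near=> h; have : ball 0 (Num.min t (1 - t)) h.
    by near: h; apply: nbhsx_ballx; rewrite lt_min t0 subr_gt0.
  rewrite /ball/= sub0r normrN lt_min => /andP[].
  by rewrite !ltr_norml => /andP[? ?] /andP[? ?]; apply/andP; split; lra.
have tt : unitI_val (clampI t) = t by rewrite clampI_val// !ltW.
have ct : clampI (h + t) @[h --> (0 : R)^'] --> (clampI t)^'.
  move=> A /= At.
  have : \forall h \near (0 : R),
      (clampI (h + t) != clampI t -> A (clampI (h + t))).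
    have ch : clampI (h + t) @[h --> (0 : R)] --> clampI t.
      rewrite -[X in nbhs (clampI X)]add0r.
      apply: (@continuous_comp _ _ _ (fun h => h + t) clampI);
        last exact: continuous_clampI.
      by apply: cvgD; [exact: cvg_id|exact: cvg_cst].
    exact: ch At.
  move=> h1; change (\forall h \near (0 : R)^', A (clampI (h + t))).
  near=> h.
  have h0 : h != 0 by near: h; exact: nbhs_dnbhs_neq.
  have : clampI (h + t) != clampI t -> A (clampI (h + t)).
    by near: h; exact: nbhs_dnbhs.
  apply; apply: contra_neq h0 => /(congr1 (@unitI_val R)).
  rewrite tt clampI_val; first by move=> /eqP; rewrite -subr_eq0 addrK => /eqP.
  by near: h; exact: nbhs_dnbhs.
have H : h^-1 *: ((g \o clampI) (h *: 1 + t) - (g \o clampI) t)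
    @[h --> (0 : R)^'] --> l.
  apply: cvg_trans (cvg_comp _ _ ct dg); apply: near_eq_cvg.
  near=> h; rewrite /= tt clampI_val; last by near: h; exact: nbhs_dnbhs.
  by rewrite addrK [h *: 1]mulr1 mulrC.
apply: DeriveDef; first by apply/cvg_ex; exists l.
exact: cvg_lim.
Unshelve. all: by end_near. Qed.

Lemma circle_piMz (x : R) (k : int) : circle_pi (k%:~R * x) = circle_pi x *~ k.
Proof.
have nat_case (n : nat) : circle_pi (n%:R * x) = circle_pi x *+ n.
  elim: n => [|n IHn];
    last by rewrite -natr1 mulrDl mul1r circle_piD IHn mulrSr.
  by rewrite mul0r; apply: (addIr (circle_pi 0)); rewrite -circle_piD !add0r.
case: k => n; first exact: nat_case.
by rewrite NegzE !mulrNz mulNr circle_piN nat_case.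
Qed.

Lemma continuous_circleMz (k : int) : continuous (fun z : K => z *~ k).
Proof.
apply: continuous_circle.
rewrite (_ : _ \o _ = @circle_pi R \o *%R k%:~R); last first.
  by apply/funext => t; rewrite /= circle_piMz.
move=> t; apply: continuous_comp; last exact: continuous_circle_pi.
exact: mulrl_continuous.
Qed.

(** The primitive on the line of [psi] minus its mean is periodic, since its
    increment over a period is the integral of [psi] minus its mean over
    [[0, 1]], which is zero. *)
Lemma circle_antiderivative (psi : K -> R) : continuous psi ->
  exists2 Psi : K -> R, continuous Psi &
    forall t : R, is_derive t (1 : R) (Psi \o @circle_pi R)
      (psi (circle_pi t) - \int[haar]_z psi z).
Proof.
move=> cpsi; set m := Rintegral _ _ _.
have cg : continuous (psi \o @circle_pi R).
  by move=> t; apply: continuous_comp;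
    [exact: continuous_circle_pi|exact: cpsi].
have [G dG] := continuous_antiderivative cg.
have cG : continuous G.
  exact: is_derive_continuous dG.
have mE : m = G 1 - G 0.
  have mpsi := continuous_measurable_circle cpsi.
  have [M psiM] := compact_continuous_bounded (@compact_circle R) cpsi.
  rewrite /m (Rintegral_pushforward_prob _ _ mpsi psiM).
  rewrite (@Rintegral_lebesgueI (psi \o (@circle_pi R \o @unitI_val R)));
    last first.
    exact: measurableT_comp mpsi measurable_circle_pi_unitI.
  rewrite (@eq_Rintegral _ _ _ leb _ (psi \o @circle_pi R)); last first.
    by move=> t; rewrite inE/= in_itv/= => t01; rewrite clampI_val.
  rewrite /Rintegral (@continuous_FTC2 _ _ G)//.
  - exact: continuous_subspaceT.
  - split; first by move=> t _; have [] := dG t.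
      by apply: cvg_at_right_filter; exact: cG.
    by apply: cvg_at_left_filter; exact: cG.
  - by move=> t _; rewrite derive1E; have [_ ->] := dG t.
pose P t := G t - m * t.
have dP (t : R) : is_derive t (1 : R) P (psi (circle_pi t) - m).
  have -> : P = G - m *: (@id R) by [].
  by apply: is_derive_eq; rewrite [m *: 1]mulr1.
have P1 t : P (t + 1) = P t.
  pose Q := P \o (id + cst 1) - P.
  have dQ (s : R) : is_derive s (1 : R) Q 0.
    have dPs := dP (s + 1).
    apply: is_derive_eq; rewrite addr0 mulr1.
    rewrite (_ : circle_pi (s + 1) = circle_pi s) ?subrr//.
    by apply/circle_pi_eq; rewrite addrAC subrr add0r; exact: intr_int 1.
  have QE r : Q r = P (r + 1) - P r by [].
  have := is_derive_0_is_cst t 0 dQ.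
  by rewrite !QE add0r /P mE; lra.
exists (P \o @circle_frac R).
  apply: continuous_circle.
  rewrite (_ : _ \o _ = P); last by apply/funext => t; rewrite /= circle_fracE.
  exact: is_derive_continuous dP.
move=> t; rewrite (_ : _ \o _ = P)//.
by apply/funext => s; rewrite /= circle_fracE.
Qed.

End unitI_transfer.

(** * Oscillating integrals with a smooth amplitude *)

Section oscillatory.
Context {R : realType}.
Local Notation I := (unitI R).
Local Notation K := (circle R).
Notation leb := (@lebesgue_measure R).

Let derive_LRcontinuous (F dF : R -> R) : continuous F ->
  (forall t : R, 0 < t < 1 -> is_derive t (1 : R) F (dF t)) ->
  derivable_oo_LRcontinuous F 0 1 /\ {in `]0, 1[, derive1 F =1 dF}.
Proof.
move=> cF dF'; split; last first.
  by move=> t; rewrite in_itv/= => /dF'[_ <-]; rewrite derive1E.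
split; first by move=> t; rewrite in_itv/= => /dF'[].
  by apply: cvg_at_right_filter; exact: cF.
by apply: cvg_at_left_filter; exact: cF.
Qed.

(** The composite with a function on the circle depends on [f] only, so any lift
    of [f] that is differentiable at [t] computes its derivative. *)
Lemma is_derive_circle_comp (f : I -> K) (Psi p : K -> R) (t l : R) (k : int) :
  0 < t < 1 -> is_circle_derive f (clampI t) l ->
  (forall s : R, is_derive s (1 : R) (Psi \o @circle_pi R) (p (circle_pi s))) ->
  is_derive t (1 : R) (fun s => Psi (f (clampI s) *~ k))
    (k%:~R * l * p (f (clampI t) *~ k)).
Proof.
move=> t01 [F Ff dF] dPsi.
have dF' := is_deriveI_clamp t01 dF.
rewrite (_ : (fun s => _) =
    (Psi \o @circle_pi R) \o (k%:~R *: (F \o clampI))); last first.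
  apply/funext => s /=.
  by rewrite -Ff -circle_piMz.
have dP := dPsi ((k%:~R *: (F \o clampI)) t).
apply: is_derive_eq; rewrite mulrC; congr (_ * p _).
by rewrite -Ff -circle_piMz.
Qed.

(** Integration by parts of [v / f1] against the derivative
    [k * f1 * (psi (k f) - m)] of [Psi (k f)]: the factor [k] is gained, and [k]
    enters the remaining terms only through [Psi (k f)], which is bounded. *)
Lemma C1_oscillation (f : I -> K) (f1 f2 : I -> R) (psi : K -> R)
    (v w : R -> R) :
  (forall x, is_circle_derive f x (f1 x)) ->
    (forall x, is_deriveI f1 x (f2 x)) ->
  continuous f2 -> (forall x, f1 x != 0) -> continuous psi ->
  (forall t : R, is_derive t (1 : R) v (w t)) -> continuous w ->
  exists B, forall k : int, k != 0 ->
    `|\int[leb]_(t in `[0, 1])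
       (v t * (psi (f (clampI t) *~ k) - \int[haar]_z psi z))| <= B / `|k%:~R|.
Proof.
move=> df df1 cf2 f10 cpsi dv cw; set m := Rintegral haar _ _.
have [Psi cPsi dPsi] := circle_antiderivative cpsi.
have [M PsiM] := compact_continuous_bounded (@compact_circle R) cPsi.
have cf : continuous f.
  by apply: circle_C2_continuous; exists f1, f2.
have cf1 : continuous f1 by move=> x; exact: is_deriveI_continuous (df1 x).
have cv : continuous v.
  exact: is_derive_continuous dv.
have cc (g : I -> R) : continuous g -> continuous (g \o clampI).
  by move=> cg t; apply: continuous_comp; [exact: continuous_clampI|exact: cg].
pose s := f1 \o clampI; pose s2 := f2 \o clampI.
have s0 t : s t != 0 by exact: f10.
have cs : continuous s := cc _ cf1.
have cs2 : continuous s2 := cc _ cf2.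
have csV : continuous (fun t => (s t)^-1).
  by move=> t; exact: (continuousV (s0 t) (cs t)).
pose F t := v t / s t.
pose dF t := (w t - F t * s2 t) / s t.
have cF : continuous F.
  by move=> t; apply: (@continuousM _ _ v (fun t => (s t)^-1));
    [exact: cv|exact: csV].
have cdF : continuous dF.
  move=> t; apply: (@continuousM _ _ (fun t => w t - F t * s2 t)
    (fun t => (s t)^-1)); last exact: csV.
  apply: (@continuousB _ _ _ w (F * s2)); first exact: cw.
  by apply: continuousM; [exact: cF|exact: cs2].
have FP (t : R) : 0 < t < 1 -> is_derive t (1 : R) F (dF t).
  move=> t01; have ds : is_derive t (1 : R) s (s2 t) :=
    is_deriveI_clamp t01 (df1 _).
  have dvt := dv t.
  have -> : F = v * (fun t => (s t)^-1) by [].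
  have dsV := is_deriveV (s0 t) ds.
  apply: is_derive_eq; rewrite /dF /F -exprVn/=.
  rewrite -![_ *: _]/(_ * _); field; exact: s0.
have [FLR F'] := derive_LRcontinuous cF FP.
pose N := (`|F 1| + `|F 0|) * M + \int[leb]_(t in `[0, 1]) (M * `|dF t|).
exists N => k k0.
pose G t := Psi (f (clampI t) *~ k).
pose dG t := k%:~R * s t * (psi (f (clampI t) *~ k) - m).
have cfk : continuous (fun t => f (clampI t) *~ k).
  move=> t; apply: (@continuous_comp _ _ _ (f \o clampI) (fun z => z *~ k)).
    by apply: continuous_comp; [exact: continuous_clampI|exact: cf].
  exact: continuous_circleMz.
have cG : continuous G.
  by move=> t; exact:
    (@continuous_comp _ _ _ (fun t => f (clampI t) *~ k) Psi t (cfk t)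
      (cPsi _)).
have cpk : continuous (fun t => psi (f (clampI t) *~ k) - m).
  move=> t; apply: (@continuousB _ _ _ (fun t => psi (f (clampI t) *~ k))
    (cst m)).
    exact: (@continuous_comp _ _ _ (fun t => f (clampI t) *~ k) psi t (cfk t)
      (cpsi _)).
  exact: cst_continuous.
have cdG : continuous dG.
  move=> t; apply: (@continuousM _ _ (fun t => k%:~R * s t)
    (fun t => psi (f (clampI t) *~ k) - m)); last exact: cpk.
  apply: (@continuousM _ _ (cst k%:~R) s); [exact: cst_continuous|exact: cs].
have GP (t : R) : 0 < t < 1 -> is_derive t (1 : R) G (dG t).
  move=> t01; exact: (is_derive_circle_comp (p := fun z => psi z - m) k t01
    (df _) dPsi).
have [GLR G'] := derive_LRcontinuous cG GP.
have k0' : 0 < `|k%:~R : R| by rewrite normr_gt0 intr_eq0.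
rewrite ler_pdivlMr// mulrC -normrM.
have ci (g : R -> R) : continuous g -> leb.-integrable `[0, 1] (EFin \o g).
  move=> cg; apply: continuous_compact_integrable; first exact: segment_compact.
  exact: continuous_subspaceT.
rewrite -RintegralZl//; last first.
  apply: ci => t.
  by apply: (@continuousM _ _ v (fun t => psi (f (clampI t) *~ k) - m));
    [exact: cv|exact: cpk].
rewrite (@eq_Rintegral _ _ _ leb _ (fun t => F t * dG t)); last first.
  by move=> t _; rewrite /F /dG; field; exact: s0.
rewrite (Rintegration_by_parts ltr01 (continuous_subspaceT cdF) FLR F'
  (continuous_subspaceT cdG) GLR G').
rewrite (le_trans (ler_normB _ _))// lerD//.
  rewrite (le_trans (ler_normB _ _))// mulrDl !normrM.
  by rewrite lerD// ler_wpM2l//; exact: PsiM.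
rewrite (le_trans (le_normr_Rintegral _ _))//.
  by apply: ci => t; apply: continuousM; [exact: cdF|exact: cG].
apply: le_Rintegral => //.
- apply: ci => t; apply: (@continuous_comp _ _ _ (dF * G) Num.norm);
    last exact: norm_continuous.
  by apply: continuousM; [exact: cdF|exact: cG].
- apply: ci => t; apply: (@continuousM _ _ (cst M) (fun t => `|dF t|));
    first exact: cst_continuous.
  by apply: continuous_comp; [exact: cdF|exact: norm_continuous].
- by move=> t _; rewrite normrM mulrC ler_wpM2r//; exact: PsiM.
Qed.

End oscillatory.

(** * The Riemann-Lebesgue argument *)

Section riemann_lebesgue.
Context {R : realType}.
Local Notation I := (unitI R).
Local Notation K := (circle R).
Notation leb := (@lebesgue_measure R).

Lemma shift_unif (g : R -> R) (e : R) : continuous g -> 0 < e ->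
  exists2 d, 0 < d & forall t u, 0 <= t <= 1 -> `|u| < d ->
    `|g t - g (t + u)| < e.
Proof.
move=> cg e0.
have /compact_near_coveringP : compact `[0 : R, 1] by exact: segment_compact.
move=> /(_ R (nbhs 0) (fun u t => `|g t - g (t + u)| < e)).
case.
  move=> t _.
  have e2 : 0 < e / 2 by rewrite divr_gt0.
  have h1 : \forall q \near (t, 0 : R), `|g t - g (q.1 + q.2)| < e / 2.
    have /cvgrPdist_lt/(_ _ e2) : g (q.1 + q.2) @[q --> (t, 0 : R)] -->
        g (t + 0).
      apply: (cvg_comp (fun q : R * R => q.1 + q.2) g _ (cg (t + 0))).
      by apply: cvgD; [exact: cvg_fst|exact: cvg_snd].
    by rewrite addr0.
  have h2 : \forall q \near (t, 0 : R), `|g t - g q.1| < e / 2.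
    have /cvgrPdist_lt/(_ _ e2) : g q.1 @[q --> (t, 0 : R)] --> g t.
      apply: (cvg_comp (fun q : R * R => q.1) g _ (cg t)).
      exact: cvg_fst.
    by [].
  near=> q; rewrite /=.
  have a1 : `|g t - g (q.1 + q.2)| < e / 2 by near: q.
  have a2 : `|g t - g q.1| < e / 2 by near: q.
  move: a2; rewrite distrC => a2.
  rewrite -[X in `|X|](subrKA (g t)) (le_lt_trans (ler_normD _ _))//.
  by rewrite (splitr e) ltrD.
move=> d/= d0 hd; exists d => // t u t01 ud.
have := hd u; rewrite /ball/= sub0r normrN => /(_ ud t); apply.
by rewrite /= in_itv.
Unshelve. all: by end_near. Qed.

(** Averages [(G (t + c) - G t) / c] of [g], with [G] a primitive of [g]; by the
    mean value theorem they are values of [g] near [t]. *)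
Lemma C1_approximation (g : R -> R) (e : R) : continuous g -> 0 < e ->
  exists v w : R -> R, [/\ forall t : R, is_derive t (1 : R) v (w t),
    continuous w & forall t, 0 <= t <= 1 -> `|g t - v t| <= e].
Proof.
move=> cg e0; have [d d0 gd] := shift_unif cg e0.
have [G dG] := continuous_antiderivative cg.
pose c := d / 2; have c0 : 0 < c by rewrite divr_gt0.
exists (fun t => c^-1 * (G (t + c) - G t)), (fun t => c^-1 * (g (t + c) - g t)).
split.
- move=> t; have dGc := dG (t + c); have dGt := dG t.
  have -> : (fun t => c^-1 * (G (t + c) - G t)) = c^-1 *:
      (G \o (id + cst c) - G) by [].
  by apply: is_derive_eq; rewrite addr0 mulr1.
- have cgc : continuous (fun t => g (t + c)).
    move=> t; apply: (@continuous_comp _ _ _ (fun t => t + c) g);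
      last exact: cg.
    by apply: cvgD; [exact: cvg_id|exact: cvg_cst].
  move=> t; apply: (@continuousM _ _ (cst c^-1) (fun t => g (t + c) - g t)).
    exact: cst_continuous.
  by apply: (@continuousB _ _ _ (fun t => g (t + c)) g); [exact: cgc|exact: cg].
- move=> t t01.
  have tc : t < t + c by rewrite ltrDl.
  have cG : {within `[t, t + c], continuous G}.
    by apply: continuous_subspaceT; exact: is_derive_continuous dG.
  have [x] := @MVT R G g t (t + c) tc (fun x _ => dG x) cG.
  rewrite in_itv/= => /andP[tx xc] ->.
  rewrite addrAC subrr add0r mulrC mulfK ?gt_eqF// -[x](subrKC t).
  apply/ltW/gd => //; rewrite ger0_norm ?subr_ge0 ?ltW//.
  by move: xc; rewrite /c; lra.
Qed.

(** The oscillating factor is bounded uniformly in [n], so the amplitude [h] may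
    be replaced by a C1 function close to it in L1, for which
    [C1_oscillation] applies. *)
Lemma riemann_lebesgue (f : I -> K) (psi : K -> R) (h : R -> R)
    (k : nat -> int) :
  circle_C2 f -> (forall x l, is_circle_derive f x l -> l != 0) ->
  continuous psi -> leb.-integrable `[0, 1] (EFin \o h) ->
  (forall n, `|k n|%N = n) ->
  \int[leb]_(t in `[0, 1])
    (h t * (psi (f (clampI t) *~ k n) - \int[haar]_z psi z)) @[n --> \oo] --> 0.
Proof.
move=> fC2 f'0 cpsi ih kn; set m := Rintegral haar _ _.
have cf := circle_C2_continuous fC2.
have [f1 [f2 [df df1 cf2]]] := fC2.
have f10 x : f1 x != 0 := f'0 _ _ (df x).
pose p n t := psi (f (clampI t) *~ k n) - m.
have cp n : continuous (p n).
  move=> t; apply: (@continuousB _ _ _ (fun t => psi (f (clampI t) *~ k n))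
    (cst m)).
    apply: (@continuous_comp _ _ _ (fun t => f (clampI t) *~ k n) psi);
      last exact: cpsi.
    apply: (@continuous_comp _ _ _ (f \o clampI) (fun z => z *~ k n)).
      by apply: continuous_comp; [exact: continuous_clampI|exact: cf].
    exact: continuous_circleMz.
  exact: cst_continuous.
have [M psiM] := compact_continuous_bounded (@compact_circle R) cpsi.
pose N := M + `|m| + 1.
have N0 : 0 < N by rewrite ltr_wpDl// addr_ge0// (le_trans _ (psiM point)).
have pN n t : `|p n t| <= N.
  by rewrite (le_trans (ler_normB _ _))// -[leLHS]addr0 lerD// lerD.
have ic (g : R -> R) : continuous g -> leb.-integrable `[0, 1] (EFin \o g).
  move=> cg; apply: continuous_compact_integrable; first exact: segment_compact.
  exact: continuous_subspaceT.
have ip n (g : R -> R) : leb.-integrable `[0, 1] (EFin \o g) ->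
    leb.-integrable `[0, 1] (EFin \o (fun t => g t * p n t)).
  move=> ig.
  have : leb.-integrable `[0, 1] ((EFin \o g) \* (EFin \o p n))%E.
    apply: integrableMl => //.
      by apply: measurable_funTS; apply: continuous_measurable_fun; exact: cp.
    exists N; split; first exact: num_real.
    by move=> y Ny t _; apply: (le_trans (pN n t)); exact: ltW.
  exact.
have iB (g1 g2 : R -> R) : leb.-integrable `[0, 1] (EFin \o g1) ->
    leb.-integrable `[0, 1] (EFin \o g2) ->
    leb.-integrable `[0, 1] (EFin \o (fun t => g1 t - g2 t)).
  move=> i1 i2; have : leb.-integrable `[0, 1] ((EFin \o g1) \- (EFin \o g2))%E.
    exact: integrableB.
  exact.
apply/cvgrPdist_le => e e0.
(* The two approximations of [h] each cost [d * N], in total [e / 2]. *)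
pose d := e / (4 * N).
have d0 : 0 < d by rewrite divr_gt0// mulr_gt0.
have [g cg [ig hg]] : exists2 g : R -> R, continuous g &
    leb.-integrable `[0, 1] (EFin \o g) /\
    \int[leb]_(t in `[0, 1]) `|h t - g t| <= d.
  have lebfin : (leb `[0%R, 1%R] < +oo)%E.
    by rewrite lebesgue_measure_itv/= lte_fin ltr01 oppr0 adde0 ltry.
  have [g_ [cg ig gh]] :=
      approximation_continuous_integrable (measurable_itv _) lebfin ih.
  have /fine_cvgP[_ /cvgrPdist_le/(_ _ d0)[n _ /(_ n (leqnn _))]] := gh.
  rewrite sub0r normrN /= => hn.
  exists (g_ n); first exact: cg.
  by split; [exact: ig|exact: le_trans (ler_norm _) hn].
have [v [w [dv cw gv]]] := C1_approximation cg d0.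
have cv : continuous v.
  exact: is_derive_continuous dv.
have [B hB] := C1_oscillation df df1 cf2 f10 cpsi dv cw.
have split_int n : \int[leb]_(t in `[0, 1]) (h t * p n t) =
    \int[leb]_(t in `[0, 1]) ((h t - v t) * p n t) +
    \int[leb]_(t in `[0, 1]) (v t * p n t).
  rewrite -RintegralD//.
  - by apply: eq_Rintegral => t _; rewrite -mulrDl subrK.
  - by apply: ip; apply: iB => //; exact: ic.
  - by apply: ip; exact: ic.
have hv n : `|\int[leb]_(t in `[0, 1]) ((h t - v t) * p n t)| <= e / 2.
  have ihg : leb.-integrable `[0, 1] (EFin \o (fun t => `|h t - g t|)).
    by apply: integrable_norm => //; exact: iB.
  have idd : leb.-integrable `[0, 1] (EFin \o (fun=> d)).
    by apply: ic; exact: cst_continuous.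
  have ihd : leb.-integrable `[0, 1] (EFin \o (fun t => `|h t - g t| + d)).
    have : leb.-integrable `[0, 1]
        ((EFin \o (fun t => `|h t - g t|%R)) \+ (EFin \o (fun=> d)))%E.
      exact: integrableD.
    exact.
  apply: (@le_trans _ _ (\int[leb]_(t in `[0, 1]) ((`|h t - g t| + d) * N))).
    apply: le_trans (le_normr_Rintegral _ _) _ => //.
      by apply: ip; apply: iB => //; exact: ic.
    apply: le_Rintegral => //.
    - apply: integrable_norm => //.
      by apply: ip; apply: iB => //; exact: ic.
    - have : leb.-integrable `[0, 1]
          ((EFin \o (fun t => `|h t - g t| + d)%R) \* cst N%:E)%E.
        exact: integrableZr.
      exact.
    - move=> t /= t01; rewrite normrM ler_pM//.
      rewrite -[h t - v t](subrKA (g t)) (le_trans (ler_normD _ _))// lerD2l.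
      by apply: gv; rewrite in_itv in t01.
  rewrite RintegralZr//.
  rewrite RintegralD// Rintegral_cst//= lebesgue_measure_itv/= lte_fin ltr01.
  rewrite oppr0 addr0 mulr1.
  rewrite (@le_trans _ _ ((d + d) * N))//.
    by rewrite ler_wpM2r// ?(ltW N0)// lerD.
  rewrite /d; have N00 : N != 0 by rewrite gt_eqF.
  by rewrite le_eqVlt; apply/orP; left; apply/eqP; field.
have e2 : 0 < e / 2 by rewrite divr_gt0.
near=> n.
rewrite sub0r normrN split_int (le_trans (ler_normD _ _))// (splitr e) lerD//.
have n0 : (0 < n)%N by near: n; exact: nbhs_infty_gt.
have kn0 : k n != 0 by rewrite -absz_gt0 kn.
apply: le_trans (hB _ kn0) _.
rewrite -intr_norm -abszE kn.
rewrite ler_pdivrMr ?ltr0n// mulrC -ler_pdivrMr//.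
by near: n; exact: nbhs_infty_ger.
Unshelve. all: by end_near. Qed.

End riemann_lebesgue.

(** * Equidistribution on a measure with given fibers *)

Section Rintegral_probability.
Context d (T : measurableType d) (R : realType) (P : probability T R).

Lemma Rintegral_sum_ord (N : nat) (F : 'I_N -> T -> R) :
  (forall j, P.-integrable setT (EFin \o F j)) ->
  \int[P]_x (\sum_j F j x) = \sum_j \int[P]_x F j x.
Proof.
move=> iF; rewrite /Rintegral sum_fine; last first.
  by move=> j _; apply: integrable_fin_num => //; exact: iF.
congr fine; rewrite -integral_sum//; apply: eq_integral => x _.
by rewrite sumEFin.
Qed.

Lemma Rintegral_close (F G : T -> R) (e : R) :
  P.-integrable setT (EFin \o F) -> P.-integrable setT (EFin \o G) ->
  (forall x, `|F x - G x| <= e) -> `|\int[P]_x F x - \int[P]_x G x| <= e.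
Proof.
move=> iF iG FG; rewrite -RintegralB//.
have iFG : P.-integrable setT (EFin \o (fun x => F x - G x)).
  have : P.-integrable setT ((EFin \o F) \- (EFin \o G))%E.
    exact: integrableB.
  exact.
rewrite (le_trans (le_normr_Rintegral _ _))//.
rewrite (@le_trans _ _ (\int[P]_x (cst e x)))//.
  apply: le_Rintegral => //; first exact: integrable_norm.
  by apply: (@bounded_integrable _ _ _ _ (cst e) `|e|).
by rewrite Rintegral_cst// [X in fine X](probability_setT P) mulr1.
Qed.

End Rintegral_probability.

Section product.
Context d1 d2 (T1 : measurableType d1) (T2 : measurableType d2) (R : realType).
Variables (P : probability T1 R) (Q : probability T2 R).

Lemma Rintegral_prodM (a : T1 -> R) (b : T2 -> R) (M N : R) :
  measurable_fun setT a -> measurable_fun setT b ->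
  (forall x, 0 <= a x <= M) -> (forall y, 0 <= b y <= N) ->
  \int[(P \x Q)%E]_q (a q.1 * b q.2) = \int[P]_x a x * \int[Q]_y b y.
Proof.
move=> ma mb aM bN.
have a0 x : 0 <= a x by have /andP[] := aM x.
have b0 x : 0 <= b x by have /andP[] := bN x.
have ib : Q.-integrable setT (EFin \o b).
  apply: (@bounded_integrable _ _ _ _ _ N) => // y.
  by rewrite ger0_norm//; have /andP[] := bN y.
have ia : P.-integrable setT (EFin \o a).
  apply: (@bounded_integrable _ _ _ _ _ M) => // y.
  by rewrite ger0_norm//; have /andP[] := aM y.
rewrite /Rintegral -fineM; [|exact: integrable_fin_num..].
congr fine; rewrite fubini_tonelli1/=; last 2 first.
- apply/measurable_EFinP; apply: measurable_funM; exact: measurableT_comp.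
- by move=> q; rewrite lee_fin mulr_ge0.
rewrite -ge0_integralZr//; last 3 first.
- exact/measurable_EFinP.
- by move=> x _; rewrite lee_fin.
- by apply: integral_ge0 => y _; rewrite lee_fin.
apply: eq_integral => x _; rewrite /fubini_F/=.
rewrite -ge0_integralZl//; first exact/measurable_EFinP.
by move=> y _; rewrite lee_fin.
by rewrite lee_fin.
Qed.

End product.

Section equidistribution.
Context {R : realType}.
Local Notation I := (unitI R).
Local Notation K := (circle R).
Notation leb := (@lebesgue_measure R).

(** The function [c] is the conditional expectation of [a] given the first
    coordinate; integrating over the fibers gives a version of it. *)
Lemma fiber_mean (kn : I -> pprobability K R) (mk : measurable_fun setT kn)
    (a : I * K -> R) (C : R) :
  measurable_fun setT a -> (forall p, 0 <= a p <= C) ->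
  exists c : I -> R, [/\ measurable_fun setT c, forall x, 0 <= c x <= C &
    forall (q : I -> R), measurable_fun setT q -> (forall x, 0 <= q x) ->
    \int[leb_of_fibers mk]_p (a p * q p.1) = \int[lebesgueI]_x (c x * q x)].
Proof.
move=> ma aC.
have a0 p : 0 <= a p by have /andP[] := aC p.
have max x : measurable_fun setT (fun y => a (x, y)).
  exact: measurableT_comp ma (pair1_measurable x).
pose c x := \int[kn x]_y a (x, y).
have cE x : (c x)%:E = (\int[kn x]_y (a (x, y))%:E)%E.
  rewrite fineK//; apply: integrable_fin_num => //.
  apply: (@bounded_integrable _ _ _ _ _ C) => // y.
  by rewrite ger0_norm//; have /andP[] := aC (x, y).
exists c; split.
- apply/measurable_EFinP.
  rewrite (_ : EFin \o c = fun x => (\int[kn x]_y (a (x, y))%:E)%E); last first.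
    by apply/funext => x /=; rewrite cE.
  apply: (measurable_fun_integral_finite_kernel (fun p => (a p)%:E)
    (kprobability mk)).
    by move=> p; rewrite lee_fin.
  exact/measurable_EFinP.
- move=> x; rewrite -!lee_fin cE integral_ge0 => [/=|y _];
    last by rewrite lee_fin.
  apply: (@le_trans _ _ (\int[kn x]_y (cst C%:E y)))%E.
    apply: ge0_le_integral => //.
    + by move=> y _; rewrite lee_fin.
    + exact/measurable_EFinP.
    + by move=> y _; rewrite lee_fin; have /andP[] := aC (x, y).
  by rewrite integral_cst// [X in (_ * X)%E](probability_setT (kn x)) mule1.
- move=> q mq q0; congr fine.
  rewrite ge0_integral_leb_of_fibers; last 2 first.
  + apply/measurable_EFinP; apply: measurable_funM => //.
    exact: measurableT_comp.
  + by move=> p; rewrite lee_fin mulr_ge0.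
  apply: eq_integral => x _ /=; rewrite EFinM cE -ge0_integralZr//.
  + exact/measurable_EFinP.
  + by move=> y _; rewrite lee_fin.
  + by rewrite lee_fin.
Qed.

(** The weight depends on [p] only through [p.1], so [a] may be replaced by its
    mean on fibers, a function on the interval. *)
Lemma fiber_equidistribution (f : I -> K) (kn : I -> pprobability K R)
    (mk : measurable_fun setT kn) (a : I * K -> R) (C : R) (psi : K -> R)
    (k : nat -> int) :
  circle_C2 f -> (forall x l, is_circle_derive f x l -> l != 0) ->
  measurable_fun setT a -> (forall p, 0 <= a p <= C) ->
  continuous psi -> (forall z, 0 <= psi z) -> (forall n, `|k n|%N = n) ->
  \int[leb_of_fibers mk]_p (a p * psi (f p.1 *~ k n)) @[n --> \oo] -->
    \int[leb_of_fibers mk]_p a p * \int[haar]_z psi z.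
Proof.
move=> fC2 f'0 ma aC cpsi psi0 kn_abs.
have [c [mc cC cE]] := fiber_mean mk ma aC.
have mpsi := continuous_measurable_circle cpsi.
have mq n : measurable_fun setT (fun x => psi (f x *~ k n)).
  exact: measurableT_comp mpsi (circle_C2_mulz_measurable (k n) fC2).
have mcc : measurable_fun setT (c \o clampI).
  exact: measurableT_comp mc measurable_clampI.
have lebfin : (leb `[0%R, 1%R] < +oo)%E.
  by rewrite lebesgue_measure_itv/= lte_fin ltr01 oppr0 adde0 ltry.
have ibnd (g : R -> R) (B : R) : measurable_fun setT g ->
    (forall t, `|g t| <= B) -> leb.-integrable `[0, 1] (EFin \o g).
  move=> mg gB; apply: measurable_bounded_integrable => //.
    exact: measurable_funTS.
  exists B; split; first exact: num_real.
  by move=> y By t _; apply: (le_trans (gB t)); exact: ltW.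
have cB t : `|c (clampI t)| <= C.
  by have /andP[? ?] := cC (clampI t); rewrite ger0_norm.
have [M psiM] := compact_continuous_bounded (@compact_circle R) cpsi.
have icc : leb.-integrable `[0, 1] (EFin \o (c \o clampI)) by exact: ibnd cB.
set m := Rintegral haar _ _.
have -> : \int[leb_of_fibers mk]_p a p = \int[leb]_(t in `[0, 1]) c (clampI t).
  have := cE (cst 1) (measurable_cst _) (fun=> ler01).
  under eq_Rintegral do rewrite mulr1.
  under [in RHS]eq_Rintegral do rewrite mulr1.
  by rewrite Rintegral_lebesgueI.
have -> : (fun n => \int[leb_of_fibers mk]_p (a p * psi (f p.1 *~ k n))) =
    (fun n => \int[leb]_(t in `[0, 1])
      (c (clampI t) * (psi (f (clampI t) *~ k n) - m)) +
      (\int[leb]_(t in `[0, 1]) c (clampI t)) * m).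
  apply/funext => n; rewrite (cE (fun x => psi (f x *~ k n)))//.
  rewrite Rintegral_lebesgueI; last exact: measurable_funM.
  rewrite -RintegralZr// -RintegralD//; last 2 first.
  - apply: (@ibnd _ (C * (M + `|m|))) => [|t].
      apply: measurable_funM => //; apply: measurable_funB => //.
      exact: measurableT_comp (mq n) measurable_clampI.
    rewrite normrM ler_pM// (le_trans (ler_normB _ _))// lerD//.
  - apply: (@ibnd _ (C * `|m|)) => [|t]; first exact: measurable_funM.
    by rewrite normrM ler_pM.
  by apply: eq_Rintegral => t _; rewrite -mulrDr subrK.
rewrite -[X in _ --> X]add0r; apply: cvgD; last exact: cvg_cst.
exact: riemann_lebesgue.
Qed.

End equidistribution.

(** * Convergence of the convolutions *)

Section convergence.
Context {R : realType}.
Local Notation I := (unitI R).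
Local Notation K := (circle R).

(** After separation of variables, the two integrals of [phi] are within [e / 3]
    of sums [S n] and [L], and [S n] tends to [L] term by term. *)
Lemma fiber_convolution_cvg_ge0 (f : I -> K) (f_C2 : circle_C2 f)
    (f'_neq0 : forall x l, is_circle_derive f x l -> l != 0)
    (mu : leb_measure R) (k : nat -> int) (k_abs : forall n, `|k n|%N = n)
    (phi : I * K -> R) (C : R) :
  continuous phi -> (forall p, 0 <= phi p <= C) ->
  \int[fiber_convolution
    (graph_measure (circle_C2_mulz_measurable (k n) f_C2)) mu]_p phi p
    @[n --> \oo] --> \int[leb_haar R]_p phi p.
Proof.
move=> cphi phiC; have mphi := continuous_measurable_prod cphi.
have phi_norm p : `|phi p| <= C by have /andP[? ?] := phiC p; rewrite ger0_norm.
pose M : leb_measure R := leb_of_fibers (measurable_disintegration mu).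
have mf n := circle_C2_mulz_measurable (k n) f_C2.
have -> : (fun n => \int[fiber_convolution (graph_measure (mf n)) mu]_p phi p) =
    (fun n => \int[M]_p phi (p.1, f p.1 *~ k n + p.2)).
  apply/funext => n.
  rewrite -(Rintegral_pushforward_prob M (measurable_shear (mf n)) mphi
    phi_norm).
  congr fine; apply: eq_measure_integral => A mA _.
  exact: fiber_convolution_graph.
have -> : \int[leb_haar R]_p phi p =
    \int[(M \x haar)%E]_q phi (q.1.1, q.2 + q.1.2).
  rewrite -(Rintegral_pushforward_prob (M \x haar)%E measurable_shift_snd mphi
    phi_norm).
  congr fine; apply: eq_measure_integral => A mA _.
  exact: leb_haar_pushforward.
apply/cvgrPdist_le => e e0.
have e3 : 0 < e / 3 by rewrite divr_gt0.
have [N [t [psi [cpsi psi0 apx]]]] := separate_shift cphi e3.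
pose a j (p : I * K) := phi (p.1, t j + p.2).
have ma j : measurable_fun setT (a j).
  exact: (measurableT_comp mphi (measurable_shear (measurable_cst (t j)))).
have aC j p : 0 <= a j p <= C by exact: phiC.
have /choice[B psiB] : forall j, exists B, forall z, `|psi j z| <= B.
  by move=> j; exact: compact_continuous_bounded (@compact_circle R) (cpsi j).
have mpsi j := continuous_measurable_circle (cpsi j).
have normM j p z : `|psi j z * a j p| <= B j * C.
  by rewrite normrM ler_pM//; exact: phi_norm.
pose S n := \sum_j \int[M]_p (a j p * psi j (f p.1 *~ k n)).
pose L := \sum_j (\int[M]_p a j p * \int[haar]_z psi j z).
have SL : S n @[n --> \oo] --> L.
  rewrite /S /L; apply: cvg_big => [|j _]; first exact: add_continuous.
  exact: fiber_equidistribution.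
have Sn n : `|\int[M]_p phi (p.1, f p.1 *~ k n + p.2) - S n| <= e / 3.
  have mk : measurable_fun setT (fun p : I * K => f p.1 *~ k n).
    exact: (measurableT_comp (mf n) measurable_fst).
  have ij j : M.-integrable setT
      (EFin \o (fun p => psi j (f p.1 *~ k n) * a j p)).
    apply: (@bounded_integrable _ _ _ _ _ (B j * C)) => //.
    by apply: measurable_funM => //; exact: measurableT_comp (mpsi j) mk.
  have -> : S n = \int[M]_p \sum_j psi j (f p.1 *~ k n) * a j p.
    rewrite Rintegral_sum_ord//; apply: eq_bigr => j _.
    by apply: eq_Rintegral => p _; rewrite mulrC.
  apply: Rintegral_close => [||p]; last exact: apx.
    apply: (@bounded_integrable _ _ _ _ _ C) => //.
    exact: (measurableT_comp mphi (measurable_shear (mf n))).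
  apply: (@bounded_integrable _ _ _ _ _ (\sum_j B j * C)) => [|p].
    apply: measurable_sum => j.
    by apply: measurable_funM => //; exact: measurableT_comp (mpsi j) mk.
  by rewrite (le_trans (ler_norm_sum _ _ _))// ler_sum.
have Lh : `|\int[(M \x haar)%E]_q phi (q.1.1, q.2 + q.1.2) - L| <= e / 3.
  have m2 j : measurable_fun setT (fun q : (I * K) * K => psi j q.2 * a j q.1).
    by apply: measurable_funM; exact: measurableT_comp.
  have ij j : (M \x haar)%E.-integrable setT
      (EFin \o (fun q : (I * K) * K => psi j q.2 * a j q.1)).
    by apply: (@bounded_integrable _ _ _ _ _ (B j * C)).
  have -> : L = \int[(M \x haar)%E]_q \sum_j psi j q.2 * a j q.1.
    rewrite Rintegral_sum_ord//; apply: eq_bigr => j _.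
    rewrite -(@Rintegral_prodM _ _ _ _ _ _ _ _ _ C (B j))//; last first.
      by move=> z; rewrite psi0/= (le_trans (ler_norm _)).
    by apply: eq_Rintegral => q _; rewrite mulrC.
  apply: Rintegral_close => [||q]; last exact: apx.
    apply: (@bounded_integrable _ _ _ _ _ C) => //.
    exact: (measurableT_comp mphi measurable_shift_snd).
  apply: (@bounded_integrable _ _ _ _ _ (\sum_j B j * C)) => [|q].
    exact: measurable_sum.
  by rewrite (le_trans (ler_norm_sum _ _ _))// ler_sum.
near=> n.
have SLn : `|L - S n| <= e / 3.
  by near: n; move/cvgrPdist_le : SL; exact.
have := Sn n; move: Lh SLn.
set x := Rintegral _ _ _; set y := Rintegral _ _ _ => xL LS yS.
rewrite (_ : x - y = (x - L) + (L - S n) + (S n - y)); last by ring.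
rewrite (le_trans (ler_normD _ _))// (_ : e = e / 3 + e / 3 + e / 3);
  last by field.
by rewrite lerD// 1?distrC// (le_trans (ler_normD _ _))// lerD.
Unshelve. all: by end_near. Qed.

(** Adding a constant to [phi] changes all the integrals by that constant, hence
    the reduction to nonnegative [phi]. *)
Lemma fiber_convolution_cvg (f : I -> K) (f_C2 : circle_C2 f)
    (f'_neq0 : forall x l, is_circle_derive f x l -> l != 0)
    (mu : leb_measure R) (k : nat -> int) :
  (forall n, `|k n|%N = n) ->
  fiber_convolution
    (graph_measure (circle_C2_mulz_measurable (k n) f_C2)) mu
    @[n --> \oo] --> leb_haar R.
Proof.
move=> k_abs; apply/leb_cvgP => phi cphi.
have [C phiC] : exists C, forall p, `|phi p| <= C.
  apply: compact_continuous_bounded cphi; rewrite -setXTT.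
  by apply: compact_setX; [exact: compact_unitI|exact: compact_circle].
have mphi := continuous_measurable_prod cphi.
have C0 : 0 <= C by exact: le_trans (phiC point).
have E (nu : probability (I * K)%type R) :
    \int[nu]_p phi p = \int[nu]_p (phi p + C) - C.
  rewrite RintegralD//; last 2 first.
  - exact: bounded_integrable phiC.
  - by apply: (@bounded_integrable _ _ _ _ _ C) => // p; rewrite ger0_norm.
  by rewrite Rintegral_cst// [X in fine X](probability_setT nu) mulr1 addrK.
rewrite E.
rewrite (eq_cvg _ _ (fun nu : leb_measure R => E nu)).
apply: cvgB; last exact: cvg_cst.
apply: (@fiber_convolution_cvg_ge0 _ _ _ _ _ _ _ (C + C)) => //.
  move=> p; apply: (@continuousD _ _ _ phi (cst C)); first exact: cphi.
  exact: cst_continuous.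
move=> p; have := phiC p; rewrite ler_norml => /andP[h1 h2].
by rewrite lerD2r h2 andbT -lerBlDr sub0r.
Qed.

End convergence.

Theorem proposition3p1 (R : realType) (f : unitI R -> circle R)
    (f_C2 : circle_C2 f)
    (f'_neq0 : forall x l, is_circle_derive f x l -> l != 0)
    (mu : leb_measure R) :
  (fiber_convolution
     (graph_measure (circle_C2_mulz_measurable n%:Z f_C2)) mu
     @[n --> \oo] --> leb_haar R) /\
  (fiber_convolution
     (graph_measure (circle_C2_mulz_measurable (- n%:Z) f_C2)) mu
     @[n --> \oo] --> leb_haar R).
Proof.
split; first exact: (fiber_convolution_cvg f_C2 f'_neq0 mu (k := Posz)).
apply: (fiber_convolution_cvg f_C2 f'_neq0 mu (k := fun n => - n%:Z)) => n.
by rewrite abszN.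
Qed.
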